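(* Fix $h>0$ and $T>0$, let $\kappa\ge\|f'\|_{C[-\beta,\beta]}$ and $\|u_{\rm init}\|_\infty\le\beta$, and assume that the exact solution $u_{h,e}$ of the space-discrete problem is smooth enough on $[0,T]$ (that is, of class $C^k$ on $[0,T]$ for some sufficiently large absolute integer $k$). Then there exist $\tau_0>0$ and a constant $C_{h,2}>0$ independent of $\tau$ (and of $n$) such that for all $0<\tau\le\tau_0$ the GSAV-EI2 iterates satisfy $$\|u^n-u_{h,e}(t_n)\|+|s^n-s_{h,e}(t_n)|\le C_{h,2}\,\tau^2,\qquad 0\le n\le\lfloor T/\tau\rfloor .$$
   Context: Spatial setting. Let $L>0$, $\Omega=(0,L)\times(0,L)$, $|\Omega|=L^2$, $M$ a positive integer, $h=L/M$. Let $\mathcal{M}_h$ be the finite-dimensional space of real grid functions $v=(v_{ij})_{i,j\in\mathbb{Z}}$ that are $M$-periodic in each index. For $v,w\in\mathcal{M}_h$ set $\langle v,w\rangle=h^2\sum_{i,j=1}^M v_{ij}w_{ij}$, $\|v\|=\sqrt{\langle v,v\rangle}$, $\|v\|_\infty=\max_{1\le i,j\le M}|v_{ij}|$. The discrete Laplacian is $\Delta_h v_{ij}=h^{-2}(v_{i+1,j}+v_{i-1,j}+v_{i,j+1}+v_{i,j-1}-4v_{ij})$. Scalar functions act on grid functions pointwise; functions of self-adjoint linear operators on $\mathcal{M}_h$ are understood as matrix functions; $I$ is the identity. Standing assumptions. $\varepsilon>0$; $f:\mathbb{R}\to\mathbb{R}$ is continuously differentiable and there is a constant $\beta>0$ (fixed)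 with $f(\beta)\le 0\le f(-\beta)$; $\|f'\|_{C[-\beta,\beta]}=\max_{[-\beta,\beta]}|f'|$; $F$ is a function with $F'=-f$; $u_{\rm init}\in\mathcal{M}_h$ is the (grid-projected) initial value; $\kappa>0$ is a stabilizing constant; $\sigma:\mathbb{R}\to\mathbb{R}$ is continuously differentiable with $\sigma>0$ and $\sigma'\ge0$ on $\mathbb{R}$. Notation. $E_{1h}(v)=\langle F(v),1\rangle$ and $g(v,r)=\sigma(r)/\sigma(E_{1h}(v))$ for $v\in\mathcal{M}_h$, $r\in\mathbb{R}$. Exact solution. $u_{h,e}:[0,\infty)\to\mathcal{M}_h$ is the solution of $\frac{d u_h}{dt}=\varepsilon^2\Delta_h u_h+f(u_h)$, $u_h(0)=u_{\rm init}$ (it satisfies $\|u_{h,e}(t)\|_\infty\le\beta$ for all $t$ when $\|u_{\rm init}\|_\infty\le\beta$), and $s_{h,e}(t)=E_{1h}(u_{h,e}(t))$. For a step $\tau>0$, $t_n=n\tau$. GSAV-EI2 scheme with step $\tau>0$. $u^0=u_{\rm init}$, $s^0=E_{1h}(u^0)$; let $\phi_1(a)=a^{-1}(e^a-1)$ for $a\ne0$. For $n\ge0$, given $(u^n,s^n)$: (Prediction) with $L_\kappa^n=\kappa g(u^n,s^n)I-\varepsilon^2\Delta_h$ and $N_\kappa^n(v,r)=g(v,r)f(v)+\kappa g(u^n,s^n)v$, $$\widetilde u^{n+1}=e^{-\tau L_\kappa^n}u^n+\tau\phi_1(-\tau L_\kappa^n)N_\kappa^n(u^n,s^n),\qquad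 \widetilde s^{n+1}=s^n-g(u^n,s^n)\langle f(u^n),\widetilde u^{n+1}-u^n\rangle,$$ and $\widetilde u^{n+\frac12}=\frac12(u^n+\widetilde u^{n+1})$, $\widetilde s^{n+\frac12}=\frac12(s^n+\widetilde s^{n+1})$. (Correction) with $\widetilde g=g(\widetilde u^{n+\frac12},\widetilde s^{n+\frac12})$, $L_\kappa^{n+\frac12}=\kappa\widetilde g I-\varepsilon^2\Delta_h$ and $N_\kappa^{n+\frac12}(v,r)=g(v,r)f(v)+\kappa\widetilde g v$, $$u^{n+1}=e^{-\tau L_\kappa^{n+\frac12}}u^n+\tau\phi_1(-\tau L_\kappa^{n+\frac12})N_\kappa^{n+\frac12}(\widetilde u^{n+\frac12},\widetilde s^{n+\frac12}),$$ $$s^{n+1}=s^n-\widetilde g\,\langle f(\widetilde u^{n+\frac12}),u^{n+1}-u^n\rangle+\frac{\kappa}{2}\widetilde g\,\langle u^{n+1}-\widetilde u^{n+1},u^{n+1}-u^n\rangle.$$ *)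

(* Defs.v *)
From HB Require Import structures.
From mathcomp Require Export all_boot all_order all_algebra.
From mathcomp Require Export all_classical all_reals all_analysis.

Set Implicit Arguments.
Unset Strict Implicit.
Unset Printing Implicit Defensive.

Export Order.TTheory GRing.Theory Num.Theory.
Export numFieldNormedType.Exports.
#[global] Open Scope classical_set_scope.
#[global] Open Scope ring_scope.

(* An M-periodic grid function is given by its values on one period, the
   indices 1, ..., M being numbered 0, ..., M - 1; the shifts
   i + 1 and i - 1 are the cyclic successor and predecessor on 'I_M. *)
Notation grid R M := 'M[R]_M (only parsing).

Section Grid.
Context {R : realType} {M : nat}.
Implicit Types (h : R) (v w : grid R M).

Definition gdot h v w : R := h ^+ 2 * \sum_(i < M) \sum_(j < M) v i j * w i j.

Definition gnorm h v : R := Num.sqrt (gdot h v v).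

Definition gnorm_oo v : R := \big[Num.max/0]_(i < M) \big[Num.max/0]_(j < M) `|v i j|.

Definition glap h v : grid R M :=
  \matrix_(i < M, j < M)
    (h ^- 2 * (v (ordS i) j + v (ord_pred i) j + v i (ordS j) + v i (ord_pred j)
               - 4 * v i j)).

(* phi(A) = Q diag(phi(a_k)) Q^T, where A = Q diag(a_k) Q^T with the columns e_k
   of Q orthonormal for gdot.  For a self-adjoint A such e_k, a_k exist, and
   phi(A) does not depend on their choice. *)
Definition is_matfun h (phi : R -> R) (A B : grid R M -> grid R M) : Prop :=
  exists (a : 'I_M * 'I_M -> R) (e : 'I_M * 'I_M -> grid R M),
    [/\ forall k l, gdot h (e k) (e l) = (k == l)%:R,
        forall k, A (e k) = a k *: e k
      & forall v, B v = \sum_k (phi (a k) * gdot h (e k) v) *: e k].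

Definition matfun h (phi : R -> R) (A : grid R M -> grid R M) :
  grid R M -> grid R M := get [set B | is_matfun h phi A B].

End Grid.

(* phi1 0 is the continuous extension *)
Definition phi1 {R : realType} (a : R) : R :=
  if a == 0 then 1 else a^-1 * (expR a - 1).

Section Regularity.
Context {R : realType}.

Definition C1 (f : R -> R) : Prop :=
  (forall x, derivable f x 1) /\ continuous (derive1 f).

Definition sup_abs (a b : R) (f : R -> R) : R := sup [set `|f x| | x in `[a, b]].

(* Derivative at t relative to D: one-sided at the endpoints of an interval. *)
Definition has_deriv_in {V : normedModType R} (D : set R) (u : R -> V) (t : R) (l : V)
    : Prop :=
  (s - t)^-1 *: (u s - u t) @[s --> within D t^'] --> l.

Definition Ck_on {V : normedModType R} (k : nat) (D : set R) (u : R -> V) : Prop :=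
  exists v : nat -> R -> V,
    [/\ forall t, D t -> v 0%N t = u t,
        forall j t, (j < k)%N -> D t -> has_deriv_in D (v j) t (v j.+1 t)
      & forall j, (j <= k)%N -> {within D, continuous (v j)}].

End Regularity.

Section GSAV.
Context {R : realType} {M : nat}.
Variables (h eps kappa : R) (f F sigma : R -> R).
Implicit Types (v : grid R M) (r tau : R).

Definition E1h v : R := gdot h (map_mx F v) (const_mx 1).

Definition gfun v r : R := sigma r / sigma (E1h v).

Definition exact_solution (uinit : grid R M) (u : R -> grid R M) : Prop :=
  u 0 = uinit /\
  forall t, 0 <= t ->
    has_deriv_in `[0, +oo[ u t (eps ^+ 2 *: glap h (u t) + map_mx f (u t)).

(* L = kappa * c * I - eps^2 Delta_h and N(v, r) = g(v, r) f(v) + kappa * c * v,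
   where c is the frozen value of g. *)
Definition Lop (c : R) v : grid R M := (kappa * c) *: v - eps ^+ 2 *: glap h v.

Definition Nop (c : R) v r : grid R M := gfun v r *: map_mx f v + (kappa * c) *: v.

(* e^{-tau L} u + tau phi_1(-tau L) N(v, r) *)
Definition ei_update tau (c : R) (u v : grid R M) r : grid R M :=
  matfun h expR (fun w => - tau *: Lop c w) u
  + tau *: matfun h phi1 (fun w => - tau *: Lop c w) (Nop c v r).

Definition gsav_ei2_step tau (us : grid R M * R) : grid R M * R :=
  let: (u, s) := us in
  let c := gfun u s in
  let up := ei_update tau c u u s in
  let sp := s - c * gdot h (map_mx f u) (up - u) in
  let uh := 2^-1 *: (u + up) in
  let sh := 2^-1 * (s + sp) in
  let ch := gfun uh sh in
  let u' := ei_update tau ch u uh sh in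
  let s' := s - ch * gdot h (map_mx f uh) (u' - u)
            + kappa / 2 * ch * gdot h (u' - up) (u' - u) in
  (u', s').

Definition gsav_ei2 tau (uinit : grid R M) (n : nat) : grid R M * R :=
  iter n (gsav_ei2_step tau) (uinit, E1h uinit).

End GSAV.

(* Main.v *)
From HB Require Import structures.
Require Import Defs.
From mathcomp Require Import ring lra.

Set Implicit Arguments.
Unset Strict Implicit.
Unset Printing Implicit Defensive.

(** Put [x = (u, s)].  The space-discrete problem together with [s = E1h u] is a
    trajectory of the autonomous system [x' = G x] with
    [G (u, s) = (k, - g(u, s) <f u, k>)], [k = eps^2 Delta_h u + g(u, s) f u].
    Expanding [exp] and [phi_1] to second order, which is legitimate because [h] is fixed
    and [Delta_h] therefore bounded, shows that on bounded sets one GSAV-EI2 step is the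
    explicit midpoint step [x + tau G(x + tau/2 G x)] up to [O(tau^3)]: all terms in
    [kappa] cancel to that order.  [G] is Lipschitz on bounded sets, and although [f] is
    only C^1, the exact trajectory is as smooth in time as [u] since
    [f(u) = u' - eps^2 Delta_h u]; the midpoint rule along it thus has a local error
    [O(tau^3)], and a discrete Gronwall argument concludes. *)

(** * Spectral theorem for real symmetric matrices *)

Section Spectral.
Context {R : realType}.

(** [matfun] takes its value by choice among the operators satisfying [is_matfun], so nothing is
    known about a step until a spectral decomposition is shown to exist; hence the spectral theorem.
    Any decomposition will do, since the estimates only use that eigenvalues are bounded by the
    operator bound. All estimates are in the max norm of matrices and pairs; [h] and [M] being
    fixed, passing to [gdot] and [gnorm] only changes constants. The terms in [kappa] cancel for two
    reasons. At the current state, kappa c u occurs both in N and in L u. In the corrector, the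
    slope k contains the extra term L (uh - u), with uh the predicted midpoint; as uh - u is tau/2
    times k up to O(tau^2), this balances the term - tau^2/2 L k coming from the exponential. As f
    is only C^1, G is never Taylor expanded: states are compared through Lipschitz bounds, and
    expansions in time are made only along the trajectory. *)

Definition dotr n (u v : 'rV[R]_n) : R := \sum_i u 0 i * v 0 i.

Lemma dotrC n (u v : 'rV[R]_n) : dotr u v = dotr v u.
Proof. by apply: eq_bigr => i _; rewrite mulrC. Qed.

Lemma dotrDl n (u u' v : 'rV[R]_n) : dotr (u + u') v = dotr u v + dotr u' v.
Proof. by rewrite -big_split; apply: eq_bigr => i _; rewrite mxE mulrDl. Qed.

Lemma dotrZl n a (u v : 'rV[R]_n) : dotr (a *: u) v = a * dotr u v.
Proof. by rewrite big_distrr; apply: eq_bigr => i _; rewrite mxE -mulrA. Qed.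

Lemma dotrDr n (u v v' : 'rV[R]_n) : dotr u (v + v') = dotr u v + dotr u v'.
Proof. by rewrite dotrC dotrDl !(dotrC _ u). Qed.

Lemma dotrZr n a (u v : 'rV[R]_n) : dotr u (a *: v) = a * dotr u v.
Proof. by rewrite dotrC dotrZl dotrC. Qed.

Lemma dotrr_ge0 n (u : 'rV[R]_n) : 0 <= dotr u u.
Proof. by apply: sumr_ge0 => i _; rewrite -expr2 sqr_ge0. Qed.

Lemma dotrr_eq0 n (u : 'rV[R]_n) : dotr u u = 0 -> u = 0.
Proof.
move=> /eqP; rewrite psumr_eq0 => [/allP u0|i _]; last by rewrite -expr2 sqr_ge0.
apply/rowP => i; rewrite mxE; have := u0 i (mem_index_enum _).
by rewrite mulf_eq0 orbb => /eqP.
Qed.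

Lemma dotr_mulmx_sym n (S : 'M[R]_n) (u v : 'rV[R]_n) : S^T = S ->
  dotr (u *m S) v = dotr u (v *m S).
Proof.
move=> symS; have dE (w z : 'rV[R]_n) : dotr w z = (w *m z^T) 0 0.
  by rewrite mxE; apply: eq_bigr => i _; rewrite mxE.
by rewrite !dE trmx_mul symS mulmxA.
Qed.

Lemma sum_continuous (T : topologicalType) (I : finType) (p : I -> T -> R) :
  (forall i, continuous (p i)) -> continuous (fun x => \sum_i p i x).
Proof.
move=> cp; apply: (@continuous_big R I) => // x.
exact: (@add_continuous _ x).
Qed.

Lemma continuous_dotr n (T : topologicalType) (p q : T -> 'rV[R]_n) :
  (forall i, continuous (fun x => p x 0 i)) ->
  (forall i, continuous (fun x => q x 0 i)) ->
  continuous (fun x => dotr (p x) (q x)).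
Proof.
by move=> cp cq; apply: sum_continuous => i x; apply: continuousM; [exact: cp|exact: cq].
Qed.

(** Each squared entry is at most [dotr x x], which bounds the set in the max norm. This is the set
    on which the Rayleigh quotient is maximized. *)
Lemma compact_orthogonal_sphere n k (e : 'I_k -> 'rV[R]_n) :
  compact [set x : 'rV[R]_n | (forall i, dotr (e i) x = 0) /\ dotr x x = 1].
Proof.
apply: bounded_closed_compact.
  exists 1; split => // r r1 x [_ xx1].
  apply: le_trans (ltW r1); rewrite /Num.norm /= mx_normrE.
  apply: bigmax_le => // -[i j] _ /=.
  rewrite -[leRHS]normr1 -ler_sqr ?nnegrE // !real_normK ?num_real // expr1n -xx1.
  rewrite {i}(ord1 i) /dotr (bigD1 j) //= -expr2 lerDl.
  by apply: sumr_ge0 => i _; rewrite -expr2 sqr_ge0.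
have -> : [set x : 'rV[R]_n | (forall i, dotr (e i) x = 0) /\ dotr x x = 1] =
    (\bigcap_i (dotr (e i) @^-1` [set 0])) `&` ((fun x => dotr x x) @^-1` [set 1]).
  by apply/seteqP; split => x /= [ex xx1]; split => // i; [move=> _|]; exact: ex.
apply: closedI.
  apply: closed_bigI => i _; apply: closed_comp => [x _|]; last exact: closed_eq.
  apply: (@continuous_dotr n _ (fun=> e i) id) => j; first exact: cst_continuous.
  exact: coord_continuous.
apply: closed_comp => [x _|]; last exact: closed_eq.
by apply: (@continuous_dotr n _ id id) => j; exact: coord_continuous.
Qed.

(** The test value is t = - b / (1 + q): the added 1 keeps the denominator positive when q = 0, and
    the quadratic is still negative there unless b = 0. *)
Lemma quadratic_ge0_linear_eq0 (b q : R) :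
  0 <= q -> (forall t, 0 <= 2 * t * b + t ^+ 2 * q) -> b = 0.
Proof.
move=> q0 /(_ (- b / (1 + q))).
have -> : 2 * (- b / (1 + q)) * b + (- b / (1 + q)) ^+ 2 * q =
    - (b ^+ 2 * (2 + q) / (1 + q) ^+ 2) by field; lra.
rewrite oppr_ge0 pmulr_lle0 ?invr_gt0 ?exprn_gt0; [|lra..].
rewrite pmulr_lle0; last lra.
by move=> b0; apply/eqP; rewrite -sqrf_eq0 eq_le b0 sqr_ge0.
Qed.

(* The maximizer of the Rayleigh quotient. *)
Lemma orthogonal_eigenvector n k (S : 'M[R]_n) (e : 'I_k -> 'rV[R]_n) (a : 'I_k -> R) :
  S^T = S -> (k < n)%N -> (forall i, e i *m S = a i *: e i) ->
  exists x l, [/\ forall i, dotr (e i) x = 0, dotr x x = 1 & x *m S = l *: x].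
Proof.
move=> symS ltkn eS.
pose W := [set x : 'rV[R]_n | (forall i, dotr (e i) x = 0) /\ dotr x x = 1].
have normalize y : y != 0 -> (forall i, dotr (e i) y = 0) ->
    W ((Num.sqrt (dotr y y))^-1 *: y).
  move=> y0 ey; have yy : 0 < dotr y y.
    rewrite lt_neqAle dotrr_ge0 andbT eq_sym; apply: contra y0 => /eqP.
    by move=> /dotrr_eq0 ->.
  split=> [i|]; first by rewrite dotrZr ey mulr0.
  by rewrite dotrZl dotrZr mulrA -invfM -expr2 sqr_sqrtr ?dotrr_ge0 // mulVf ?gt_eqF.
(* An n by k matrix with k < n has a nontrivial left kernel, so some nonzero vector is orthogonal to
   all the [e i]. *)
have [y y0 ey] : exists2 y : 'rV[R]_n, y != 0 & forall i, dotr (e i) y = 0.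
  pose E := (\matrix_(i < k) e i)^T.
  have /rowV0Pn [y /sub_kermxP yE y0] : kermx E != 0.
    rewrite -mxrank_eq0 mxrank_ker subn_eq0 -ltnNge.
    by apply: leq_ltn_trans ltkn; rewrite mxrank_tr rank_leq_row.
  exists y => // i; have /matrixP/(_ 0 i) := yE.
  rewrite !mxE => <-; apply: eq_bigr => j _; by rewrite !mxE mulrC.
have W0 : W !=set0 by exists ((Num.sqrt (dotr y y))^-1 *: y); exact: normalize.
have [|x /set_mem [ex xx1] xmax] := EVT_max_rV W0 (@compact_orthogonal_sphere n k e)
    (f := fun x => dotr (x *m S) x).
  apply: continuous_subspaceT; apply: continuous_dotr => i.
    under eq_fun do rewrite mxE.
    apply: sum_continuous => j x; apply: continuousM; last exact: cst_continuous.
    exact: coord_continuous.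
  exact: coord_continuous.
(* By homogeneity, maximality of x says that q is nonnegative on the whole orthogonal complement; q
   vanishes at x. *)
pose l := dotr (x *m S) x.
pose q z := l * dotr z z - dotr (z *m S) z.
have q_ge0 z : (forall i, dotr (e i) z = 0) -> 0 <= q z.
  move=> ez; have [->|z0] := eqVneq z 0.
    by rewrite /q mul0mx /dotr !big1 ?mulr0 ?subrr // => i _; rewrite mxE mul0r.
  have zz : 0 < dotr z z.
    rewrite lt_neqAle dotrr_ge0 andbT eq_sym; apply: contra z0 => /eqP.
    by move=> /dotrr_eq0 ->.
  have := xmax _ (mem_set (normalize _ z0 ez)).
  rewrite -scalemxAl dotrZl dotrZr mulrA -invfM -expr2 sqr_sqrtr ?dotrr_ge0 //.
  by rewrite ler_pdivrMl // mulrC /q subr_ge0.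
(* The residual is orthogonal to every [e i] because S is symmetric, so x + t r stays in the
   complement; the coefficient of 2 t in q (x + t r) is [dotr r r], which must therefore vanish. *)
have [r rE] : exists r, r = l *: x - x *m S by eexists.
have er i : dotr (e i) r = 0.
  rewrite rE -scaleN1r dotrDr !dotrZr ex mulr0 add0r -dotr_mulmx_sym //.
  by rewrite eS dotrZl ex !mulr0.
have qE t : q (x + t *: r) = 2 * t * dotr r r + t ^+ 2 * q r.
  have xr : dotr (x *m S) r = l * dotr x r - dotr r r.
    have -> : dotr r r = l * dotr x r - dotr (x *m S) r.
      by rewrite {1}rE -scaleN1r dotrDl !dotrZl mulN1r.
    ring.
  rewrite /q mulmxDl -scalemxAl !dotrDl !dotrDr !dotrZl !dotrZr.
  rewrite (dotr_mulmx_sym r x symS) (dotrC r (x *m S)) (dotrC r x) xr xx1 -/l.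
  ring.
have r0 : r = 0.
  apply: dotrr_eq0.
  have qr := q_ge0 _ er.
  apply: quadratic_ge0_linear_eq0 qr _ => t; rewrite -qE; apply: q_ge0 => i.
  by rewrite dotrDr dotrZr er ex mulr0 addr0.
exists x, l; split => //.
by apply/esym/eqP; rewrite -subr_eq0 -rE r0.
Qed.

(** Induction on the number k of eigenvectors already found, inside a fixed space of dimension n, so
    that S is never restricted to a complement. The new vector is placed at [ord0]. *)
Lemma symmetric_orthonormal_eigenbasis n (S : 'M[R]_n) : S^T = S ->
  exists (e : 'I_n -> 'rV[R]_n) (a : 'I_n -> R),
    (forall i j, dotr (e i) (e j) = (i == j)%:R) /\
    (forall i, e i *m S = a i *: e i).
Proof.
move=> symS.
suff: forall k, (k <= n)%N -> exists (e : 'I_k -> 'rV[R]_n) (a : 'I_k -> R),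
    (forall i j, dotr (e i) (e j) = (i == j)%:R) /\
    (forall i, e i *m S = a i *: e i) by apply.
elim=> [_|k IH ltkn].
  by exists (fun=> 0), (fun=> 0); split => [[]|[]].
have [e [a [ee eS]]] := IH (ltnW ltkn).
have [x [l [ex xx xS]]] := orthogonal_eigenvector symS ltkn eS.
exists (fun i => oapp e x (unlift ord0 i)), (fun i => oapp a l (unlift ord0 i)).
split=> [i j|i]; last by case: unliftP => [i'|] _ /=; [exact: eS|exact: xS].
case: (unliftP ord0 i) => [i'|] ->; case: (unliftP ord0 j) => [j'|] -> /=.
- by rewrite ee (inj_eq lift_inj).
- by rewrite ex.
- by rewrite dotrC ex.
- by rewrite xx.
Qed.

End Spectral.

(** * Grid operators and matrix functions *)

Section GridOperators.
Context {R : realType} {M : nat}.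
Implicit Types (h : R) (v w : grid R M).

Lemma gdot_dotr h v w : gdot h v w = h ^+ 2 * dotr (mxvec v) (mxvec w).
Proof.
congr (_ * _); rewrite pair_bigA /= /dotr (reindex _ (curry_mxvec_bij M M)) /=.
by apply: eq_bigr => -[i j] _ /=; rewrite !mxvecE.
Qed.

Lemma gdotC h v w : gdot h v w = gdot h w v.
Proof. by rewrite !gdot_dotr dotrC. Qed.

Lemma gdotDl h v v' w : gdot h (v + v') w = gdot h v w + gdot h v' w.
Proof. by rewrite !gdot_dotr linearD dotrDl mulrDr. Qed.

Lemma gdotZl h a v w : gdot h (a *: v) w = a * gdot h v w.
Proof. by rewrite !gdot_dotr linearZ dotrZl mulrCA. Qed.

Lemma gdotDr h v w w' : gdot h v (w + w') = gdot h v w + gdot h v w'.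
Proof. by rewrite gdotC gdotDl !(gdotC _ v). Qed.

Lemma gdotZr h a v w : gdot h v (a *: w) = a * gdot h v w.
Proof. by rewrite gdotC gdotZl gdotC. Qed.

Lemma gdotNr h v w : gdot h v (- w) = - gdot h v w.
Proof. by rewrite -scaleN1r gdotZr mulN1r. Qed.

Lemma gdotBr h v w w' : gdot h v (w - w') = gdot h v w - gdot h v w'.
Proof. by rewrite gdotDr gdotNr. Qed.

Lemma gdotBl h v v' w : gdot h (v - v') w = gdot h v w - gdot h v' w.
Proof. by rewrite gdotC gdotBr !(gdotC _ w). Qed.

Lemma glap_linear h : linear (@glap R M h).
Proof. by move=> a v w; apply/matrixP => i j; rewrite !mxE; ring. Qed.

HB.instance Definition _ h :=
  GRing.isLinear.Build R (grid R M) (grid R M) _ (@glap R M h) (glap_linear h).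

(** Summation by parts on the periodic grid: reindexing by the bijection [ordS] turns a forward
    shift of one factor into a backward shift of the other. *)
Lemma glap_sym h v w : gdot h (glap h v) w = gdot h v (glap h w).
Proof.
have shift1 (p q : grid R M) :
    \sum_i \sum_j p (ordS i) j * q i j = \sum_i \sum_j p i j * q (ord_pred i) j.
  rewrite [RHS](reindex _ (onW_bij _ (ordS_bij M))) /=.
  by apply: eq_bigr => i _; rewrite ordSK.
have shift2 (p q : grid R M) :
    \sum_i \sum_j p i (ordS j) * q i j = \sum_i \sum_j p i j * q i (ord_pred j).
  apply: eq_bigr => i _; rewrite [RHS](reindex _ (onW_bij _ (ordS_bij M))) /=.
  by apply: eq_bigr => j _; rewrite ordSK.
have sumC (p q : 'I_M -> 'I_M -> R) : \sum_i \sum_j p i j * q i j =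
    \sum_i \sum_j q i j * p i j.
  by apply: eq_bigr => i _; apply: eq_bigr => j _; rewrite mulrC.
(* Once backward shifts are traded for forward shifts of the other factor, the form is visibly
   symmetric in p and q. *)
have sumE (p q : grid R M) : \sum_i \sum_j glap h p i j * q i j =
    h ^- 2 * (\sum_i \sum_j p (ordS i) j * q i j + \sum_i \sum_j q (ordS i) j * p i j
     + \sum_i \sum_j p i (ordS j) * q i j + \sum_i \sum_j q i (ordS j) * p i j
     - 4 * \sum_i \sum_j p i j * q i j).
  rewrite (shift1 q) (shift2 q) ![\sum_i \sum_j q i j * _]sumC.
  rewrite -mulNr big_distrr -!big_split big_distrr; apply: eq_bigr => i _ /=.
  rewrite big_distrr -!big_split big_distrr; apply: eq_bigr => j _ /=.
  by rewrite mxE; ring.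
congr (_ * _); rewrite [RHS]sumC !sumE [\sum_i \sum_j w i j * v i j]sumC.
by congr (_ * (_ - _)); ring.
Qed.

Lemma mx_norm_leP (v : grid R M) c : 0 <= c ->
  reflect (forall i j, `|v i j| <= c) (`|v| <= c).
Proof.
move=> c0; rewrite /Num.norm /= mx_normrE; apply: (iffP (bigmax_leP _ _ _ _)).
  by move=> [_ vc] i j; apply: (vc (i, j)).
by move=> vc; split => // -[i j] _; apply: vc.
Qed.

Lemma entry_le_mx_norm v i j : `|v i j| <= `|v|.
Proof. exact: (mx_norm_leP v (normr_ge0 v)). Qed.

(** The 8 is four neighbours plus the central weight 4. *)
Lemma glap_norm_le h v : `|glap h v| <= 8 * h ^- 2 * `|v|.
Proof.
apply/mx_norm_leP => [|i j]; first by rewrite !mulr_ge0 // invr_ge0 sqr_ge0.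
rewrite mxE normrM ger0_norm; last by rewrite invr_ge0 sqr_ge0.
rewrite [8 * _]mulrC -mulrA ler_wpM2l ?invr_ge0 ?sqr_ge0 //.
have h1 := entry_le_mx_norm v (ordS i) j; have h2 := entry_le_mx_norm v (ord_pred i) j.
have h3 := entry_le_mx_norm v i (ordS j); have h4 := entry_le_mx_norm v i (ord_pred j).
have h5 := entry_le_mx_norm v i j.
move: h1 h2 h3 h4 h5; rewrite !ler_norml => /andP[? ?] /andP[? ?] /andP[? ?] /andP[? ?].
by move=> /andP[? ?]; apply/andP; split; lra.
Qed.

Lemma gdot_norm_le h v w : `|gdot h v w| <= h ^+ 2 * M%:R ^+ 2 * `|v| * `|w|.
Proof.
rewrite normrM (ger0_norm (sqr_ge0 h)) -(mulrA _ `|v|) -(mulrA (h ^+ 2)).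
have sumM (p : 'I_M -> R) c : (forall i, `|p i| <= c) -> `|\sum_i p i| <= M%:R * c.
  move=> pc; apply: le_trans (ler_norm_sum _ _ _) _.
  apply: le_trans (ler_sum _ (fun i _ => pc i)) _.
  by rewrite sumr_const card_ord mulr_natl.
apply: ler_wpM2l; first exact: sqr_ge0.
rewrite expr2 -mulrA; apply: (sumM _ _) => i; apply: (sumM _ _) => j.
by rewrite normrM ler_pM // entry_le_mx_norm.
Qed.

Lemma gnorm_le h v : 0 <= h -> gnorm h v <= h * M%:R * `|v|.
Proof.
move=> h0; rewrite -[leRHS]ger0_norm ?mulr_ge0 // -sqrtr_sqr ler_sqrt ?sqr_ge0 //.
apply: le_trans (ler_norm _) _; apply: le_trans (gdot_norm_le h v v) _.
by rewrite !exprMn -!mulrA.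
Qed.

(* Orthonormality of M^2 vectors in a space of dimension M^2 gives completeness. *)
Lemma orthonormal_expansion h (e : 'I_M * 'I_M -> grid R M) v :
  (forall k l, gdot h (e k) (e l) = (k == l)%:R) ->
  v = \sum_k gdot h (e k) v *: e k.
Proof.
move=> ee; have [g gK Kg] := curry_mxvec_bij M M.
(* The factor h makes the rows Euclidean orthonormal, [gdot] being h^2 times [dotr]. For a square
   matrix, Q Q^T = 1 yields Q^T Q = 1, which is completeness. *)
pose Q := \matrix_(r < M * M) (h *: mxvec (e (g r))).
have mulQ (u : 'rV[R]_(M * M)) r : (u *m Q^T) 0 r = h * dotr (mxvec (e (g r))) u.
  rewrite mxE big_distrr; apply: eq_bigr => s _ /=; rewrite !mxE; ring.
have QQ : Q *m Q^T = 1%:M.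
  apply/matrixP => r s; rewrite !mxE.
  transitivity (gdot h (e (g r)) (e (g s))).
    rewrite gdot_dotr big_distrr; apply: eq_bigr => l _ /=; rewrite !mxE; ring.
  rewrite ee; congr (_%:R); congr nat_of_bool; apply/eqP/eqP => [gg|-> //].
  by rewrite -(Kg r) // -(Kg s) // gg.
apply: (can_inj mxvecK).
rewrite -[LHS]mulmx1 -(mulmx1C QQ) mulmxA mulmx_sum_row linear_sum.
rewrite (reindex _ (curry_mxvec_bij M M)); apply: eq_bigr => k _.
rewrite mulQ rowK gK //= [in RHS]linearZ /= scalerA gdot_dotr; congr (_ *: _); ring.
Qed.

(** [get] satisfies its predicate only if the latter is inhabited. In the coordinates [mxvec] the
    operator becomes a symmetric matrix, because [gdot] is a nonzero multiple of [dotr]. *)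
Lemma matfun_exists h (phi : R -> R) (A : grid R M -> grid R M) :
  0 < h -> linear A -> (forall v w, gdot h (A v) w = gdot h v (A w)) ->
  is_matfun h phi A (matfun h phi A).
Proof.
move=> h0 linA symA.
have h2 : h ^+ 2 != 0 by rewrite sqrf_eq0 gt_eqF.
pose Alin := HB.pack_for {linear grid R M -> grid R M} A
  (GRing.isLinear.Build R (grid R M) (grid R M) _ A linA).
pose S := lin_mx A.
have SE v : mxvec v *m S = mxvec (A v) by apply: (mul_vec_lin Alin).
have symS : S^T = S.
  apply/matrixP => r s; rewrite mxE.
  have entryE i j : S i j = dotr (delta_mx 0 i *m S) (delta_mx 0 j).
    rewrite -rowE /dotr (bigD1 j) //= !mxE !eqxx mulr1 big1 ?addr0 // => l lj.
    by rewrite !mxE /= (negPf lj) mulr0.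
  rewrite !entryE -(vec_mxK (delta_mx 0 s)) -(vec_mxK (delta_mx 0 r)) !SE.
  apply: (mulfI h2); rewrite -!gdot_dotr symA gdotC //.
have [x [a [xx xS]]] := symmetric_orthonormal_eigenbasis symS.
rewrite /matfun; apply: (@getPex _ [set B | is_matfun h phi A B]).
(* Dividing by h turns Euclidean unit vectors into unit vectors for [gdot]. *)
pose e (k : 'I_M * 'I_M) : grid R M := h^-1 *: vec_mx (x (mxvec_index k.1 k.2)).
exists (fun v => \sum_k (phi (a (mxvec_index k.1 k.2)) * gdot h (e k) v) *: e k).
exists (fun k => a (mxvec_index k.1 k.2)), e; split => // [k l|k].
  rewrite gdotZl gdotZr gdot_dotr !vec_mxK xx.
  have -> : (mxvec_index k.1 k.2 == mxvec_index l.1 l.2) = (k == l).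
    apply/eqP/eqP => [|-> //]; case: k l => [i j] [i' j'] /= /cast_ord_inj.
    by move=> /enum_rank_inj.
  by field; rewrite gt_eqF.
apply: (can_inj mxvecK); rewrite -SE /e !linearZ /= -scalemxAl vec_mxK xS.
by rewrite scalerA mulrC -scalerA.
Qed.

End GridOperators.

(** * Taylor remainders of exp and phi_1, for scalars and then for operators *)

Section ScalarEstimates.
Context {R : realType}.

Lemma mean_value_le (p dp : R -> R) (a b K : R) : a <= b ->
  (forall x : R, a < x < b -> is_derive x 1 p (dp x)) ->
  {within `[a, b], continuous p} ->
  (forall x, a < x < b -> `|dp x| <= K) -> `|p b - p a| <= K * (b - a).
Proof.
rewrite le_eqVlt => /predU1P[->|ab] dpE cp dpK; first by rewrite !subrr normr0 mulr0.
have dpE' x : x \in `]a, b[ -> is_derive x 1 p (dp x).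
  by rewrite in_itv; exact: dpE.
have [x /[!in_itv] xab ->] := MVT ab dpE' cp.
by rewrite normrM (gtr0_norm (x := b - a)) ?subr_gt0 // ler_pM2r ?subr_gt0 // dpK.
Qed.

Lemma is_derive_within_continuous (p dp : R -> R) (A : set R) :
  (forall x : R, is_derive x 1 p (dp x)) -> {within A, continuous p}.
Proof.
move=> dpE; apply: continuous_subspaceT => x.
by apply/differentiable_continuous/derivable1_diffP; have [] := dpE x.
Qed.

(** Mean value theorem between 0 and x. The gain 1/(n+1) of a true integration is given up, so that
    the bound iterates with one constant K. *)
Lemma primitive_power_bound (p dp : R -> R) (B K : R) n : 0 <= K ->
  (forall x : R, is_derive x 1 p (dp x)) -> p 0 = 0 ->
  (forall x, `|x| <= B -> `|dp x| <= K * `|x| ^+ n) ->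
  forall x, `|x| <= B -> `|p x| <= K * `|x| ^+ n.+1.
Proof.
move=> K0 dpE p0 dpK x xB.
have bound y : `|y| <= `|x| -> `|dp y| <= K * `|x| ^+ n.
  move=> yx; apply: le_trans (dpK _ (le_trans yx xB)) _.
  by apply: ler_wpM2l => //; apply: lerXn2r; rewrite ?nnegrE.
have cp A : {within A, continuous p} := is_derive_within_continuous dpE.
rewrite exprSr mulrA; have [x0|x0] := leP 0 x.
  rewrite -[p x]subr0 -p0 [X in _ * X]ger0_norm // -[X in _ * X]subr0.
  apply: mean_value_le => // y /andP[y0 yx]; apply: bound.
  by rewrite !ger0_norm // ?ltW.
rewrite -normrN -[- p x]add0r -{1}p0 [X in _ * X]ltr0_norm // -[X in _ * X]add0r.
apply: mean_value_le => // [|y /andP[xy y0]]; first exact: ltW.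
by apply: bound; rewrite !ler0_norm ?lerN2 // ltW.
Qed.

(** Three integrations of exp <= exp B: the remainder and its first two derivatives vanish at 0. *)
Lemma expR_taylor2 (B a : R) : `|a| <= B ->
  `|expR a - (1 + a + 2^-1 * a ^+ 2)| <= expR B * `|a| ^+ 3.
Proof.
move=> aB.
apply: (@primitive_power_bound (fun a => expR a - (1 + a + 2^-1 * a ^+ 2))
    (fun a => expR a - (1 + a)) B _ _ _ _ _ _ a aB) => [||| {aB}a aB].
- exact: expR_ge0.
- by move=> x; apply: is_derive_eq; rewrite /GRing.scale /=; field.
- by rewrite expR0; ring.
apply: (@primitive_power_bound (fun a => expR a - (1 + a))
    (fun a => expR a - 1) B _ _ _ _ _ _ a aB) => [||| {aB}a aB].
- exact: expR_ge0.
- by move=> x; apply: is_derive_eq; rewrite /GRing.scale /=; ring.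
- by rewrite expR0; ring.
apply: (@primitive_power_bound (fun a => expR a - 1)
    (@expR R) B _ _ _ _ _ _ a aB) => [||| {aB}a aB].
- exact: expR_ge0.
- by move=> x; apply: is_derive_eq; rewrite subr0.
- by rewrite expR0 subrr.
by rewrite expr0 mulr1 ger0_norm ?expR_ge0 // ler_expR (le_trans (ler_norm _)).
Qed.

(** For a nonzero, this remainder is that of exp divided by a, which costs one order. *)
Lemma phi1_taylor1 (B a : R) : `|a| <= B ->
  `|phi1 a - (1 + 2^-1 * a)| <= expR B * `|a| ^+ 2.
Proof.
move=> aB; rewrite /phi1; have [->|a0] := eqVneq a 0.
  by rewrite mulr0 addr0 subrr normr0 mulr_ge0 ?expR_ge0.
have -> : a^-1 * (expR a - 1) - (1 + 2^-1 * a) =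
    a^-1 * (expR a - (1 + a + 2^-1 * a ^+ 2)) by field.
rewrite normrM normfV ler_pdivrMl ?normr_gt0 //.
by apply: le_trans (expR_taylor2 aB) _; rewrite [leRHS]mulrCA -exprS.
Qed.

End ScalarEstimates.

Section MatfunEstimates.
Context {R : realType} {M : nat}.
Implicit Types (h : R) (v w : grid R M).

(** In the eigenbasis the difference acts by the scalars phi(a_k) - (c0 + c1 a_k + c2 a_k^2). In
    M^4, one M^2 counts the eigenvectors and the other comes from bounding a coefficient
    [gdot h (e k) v] by the max norm. *)
Lemma matfun_poly2_le h (phi : R -> R) (A : grid R M -> grid R M)
    (c0 c1 c2 K B : R) m v :
  0 < h -> linear A -> (forall v w, gdot h (A v) w = gdot h v (A w)) ->
  0 <= K -> (forall v, `|A v| <= B * `|v|) ->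
  (forall a, `|a| <= B -> `|phi a - (c0 + c1 * a + c2 * a ^+ 2)| <= K * `|a| ^+ m) ->
  `|matfun h phi A v - (c0 *: v + c1 *: A v + c2 *: A (A v))|
    <= M%:R ^+ 4 * K * B ^+ m * `|v|.
Proof.
move=> h0 linA symA K0 AB phiK.
have [a [e [ee Ae ->]]] := matfun_exists phi h0 linA symA.
pose Alin := HB.pack_for {linear grid R M -> grid R M} A
  (GRing.isLinear.Build R (grid R M) (grid R M) _ A linA).
have AE : A = Alin by [].
have h2 : 0 < h ^+ 2 by rewrite exprn_gt0.
(* The terms of the sum defining [gdot h (e k) (e k)] are nonnegative, so a single squared entry is
   at most h^-2. *)
have e_le k : `|e k| <= h^-1.
  have hV : 0 <= h^-1 by rewrite invr_ge0 ltW.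
  apply/mx_norm_leP => // i j.
  rewrite -ler_sqr ?nnegrE // real_normK ?num_real // exprVn.
  rewrite -[leRHS]mul1r ler_pdivlMr // mulrC.
  have -> : 1 = gdot h (e k) (e k) by rewrite ee eqxx.
  rewrite /gdot ler_pM2l //.
  rewrite (bigD1 i) //= (bigD1 j) //= -expr2 -addrA lerDl.
  by rewrite addr_ge0 // !sumr_ge0 // => *; rewrite ?sumr_ge0 // => *; rewrite -expr2 sqr_ge0.
have a_le k : `|a k| <= B.
  have ek : 0 < `|e k|.
    rewrite normr_gt0; apply/eqP => ek0; have /eqP := ee k k.
    by rewrite eqxx ek0 -(scale0r 0) gdotZl mul0r eq_sym oner_eq0.
  by rewrite -(ler_pM2r ek) -normrZ -Ae.
have Av : A v = \sum_k (a k * gdot h (e k) v) *: e k.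
  rewrite {1}(orthonormal_expansion v ee) AE linear_sum; apply: eq_bigr => k _.
  by rewrite linearZ /= Ae scalerA mulrC.
have AAv : A (A v) = \sum_k (a k ^+ 2 * gdot h (e k) v) *: e k.
  rewrite {1}Av AE linear_sum; apply: eq_bigr => k _.
  by rewrite linearZ /= Ae scalerA; congr (_ *: _); ring.
rewrite AAv Av {2}(orthonormal_expansion v ee) !scaler_sumr -!big_split -sumrB.
apply: le_trans (ler_norm_sum _ _ _) _.
apply: (@le_trans _ _ (\sum_(k : 'I_M * 'I_M) (M%:R ^+ 2 * K * B ^+ m * `|v|))); last first.
  rewrite sumr_const card_prod card_ord -[leLHS]mulr_natl natrM.
  by rewrite (_ : M%:R * M%:R * _ = M%:R ^+ 4 * K * B ^+ m * `|v|) //; ring.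
apply: ler_sum => k _.
rewrite /= !scalerA -!scalerDl -scalerBl normrZ.
have -> : phi (a k) * gdot h (e k) v - (c0 * gdot h (e k) v +
    c1 * (a k * gdot h (e k) v) + c2 * (a k ^+ 2 * gdot h (e k) v)) =
    (phi (a k) - (c0 + c1 * a k + c2 * a k ^+ 2)) * gdot h (e k) v by ring.
rewrite normrM -[leLHS]mulrA.
have -> : M%:R ^+ 2 * K * B ^+ m * `|v| = K * B ^+ m * (M%:R ^+ 2 * `|v|) by ring.
apply: ler_pM => //.
  apply: le_trans (phiK _ (a_le k)) _; apply: ler_wpM2l => //.
  by apply: lerXn2r (a_le k); rewrite nnegrE // (le_trans _ (a_le k)).
have -> : M%:R ^+ 2 * `|v| = h ^+ 2 * M%:R ^+ 2 * h^-1 * `|v| * h^-1.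
  by field; rewrite gt_eqF.
apply: ler_pM => //.
apply: le_trans (gdot_norm_le _ _ _) _; apply: ler_wpM2r => //.
by apply: ler_wpM2l => //; rewrite mulr_ge0 ?sqr_ge0.
Qed.

End MatfunEstimates.

(** * Second-order expansion of one exponential integrator update *)

Section Step.
Context {R : realType} {M : nat} (h eps kappa : R) (f F sigma : R -> R).
Implicit Types (v w : grid R M).
Hypothesis h_gt0 : 0 < h.

Notation L := (@Lop R M h eps kappa).

Lemma Lop_linear c : linear (L c).
Proof.
by move=> a v w; apply/matrixP => i j; rewrite /Lop linearP /= !mxE; ring.
Qed.

Lemma Lop_sym c v w : gdot h (L c v) w = gdot h v (L c w).
Proof.
rewrite (gdotC _ (L c v)) /Lop !gdotBr !gdotZr (gdotC _ w v) -glap_sym.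
by rewrite (gdotC _ (glap h w)).
Qed.

Lemma Lop_norm_le c v :
  `|L c v| <= (`|kappa| * `|c| + 8 * h ^- 2 * eps ^+ 2) * `|v|.
Proof.
rewrite mulrDl; apply: le_trans (ler_normB _ _) _.
rewrite (normrZ (kappa * c)) (normrZ (eps ^+ 2)) (normrM kappa).
apply: lerD => //; rewrite (ger0_norm (sqr_ge0 _)).
rewrite (mulrC (8 * _)) -[leRHS]mulrA; apply: ler_wpM2l (glap_norm_le _ _).
exact: sqr_ge0.
Qed.

Lemma ei_update_expansion (B : R) : exists2 K, 0 <= K &
  forall (tau c : R) (u v : grid R M) r, 0 < tau -> tau <= 1 -> `|c| <= B ->
  forall N k : grid R M, N = Nop h kappa f F sigma c v r -> k = N - L c u ->
  `|ei_update h eps kappa f F sigma tau c u v r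
     - (u + tau *: k - (tau ^+ 2 / 2) *: L c k)| <= K * tau ^+ 3 * (`|u| + `|N|).
Proof.
pose Lam := `|kappa| * `|B| + 8 * h ^- 2 * eps ^+ 2.
have hV : 0 <= h ^- 2 by rewrite invr_ge0 sqr_ge0.
have Lam0 : 0 <= Lam.
  by apply: addr_ge0; apply: mulr_ge0; rewrite ?sqr_ge0 // mulr_ge0.
exists (M%:R ^+ 4 * expR Lam * (Lam ^+ 3 + Lam ^+ 2)).
  by apply: mulr_ge0; [apply: mulr_ge0; [exact: exprn_ge0|exact: expR_ge0]|
    apply: addr_ge0; exact: exprn_ge0].
move=> tau c u v r tau0 tau1 cB N k NE kE.
pose A := fun w => - tau *: L c w.
have linA : linear A.
  by move=> a w z; rewrite /A (Lop_linear c) scalerDr !scalerA mulrC.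
have symA w z : gdot h (A w) z = gdot h w (A z).
  by rewrite gdotZl gdotZr Lop_sym.
have AB w : `|A w| <= (tau * Lam) * `|w|.
  rewrite normrZ normrN gtr0_norm // -mulrA ler_pM2l //.
  apply: le_trans (Lop_norm_le _ _) _; apply: ler_wpM2r => //.
  by rewrite lerD2r ler_wpM2l // (le_trans cB) ?ler_norm.
have tL : tau * Lam <= Lam by rewrite -[leRHS]mul1r ler_wpM2r.
have expL : expR (tau * Lam) <= expR Lam by rewrite ler_expR.
have A1 := @matfun_poly2_le R M h expR A 1 1 2^-1 (expR Lam) (tau * Lam) 3 u h_gt0
  linA symA (expR_ge0 _) AB.
have A2 := @matfun_poly2_le R M h phi1 A 1 2^-1 0 (expR Lam) (tau * Lam) 2 N h_gt0
  linA symA (expR_ge0 _) AB.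
have {}A1 := A1 _; have {}A2 := A2 _.
rewrite /ei_update -NE -/A.
(* The terms in u and in N of the two expansions group into k = N - L u and L k = L N - L (L u). *)
have -> : u + tau *: k - (tau ^+ 2 / 2) *: L c k =
    (1 *: u + 1 *: A u + 2^-1 *: A (A u)) +
    tau *: (1 *: N + 2^-1 *: A N + 0 *: A (A N)).
  have Lk : L c k = L c N - L c (L c u).
    by rewrite kE addrC -scaleN1r (Lop_linear c) scaleN1r addrC.
  rewrite Lk /A kE; have -> : L c (- tau *: L c u) = - tau *: L c (L c u).
    rewrite -[_ *: L c u]addr0 (Lop_linear c) (_ : L c 0 = 0) ?addr0 //.
    by apply/eqP; rewrite -normr_le0 (le_trans (Lop_norm_le _ _)) // normr0 mulr0.
  move: (L c u) (L c N) (L c (L c u)) => Lu LN LLu.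
  by rewrite scale0r; apply/matrixP => i j; rewrite !mxE; field.
rewrite opprD addrACA -scalerBr; apply: le_trans (ler_normD _ _) _.
rewrite normrZ gtr0_norm //.
apply: (@le_trans _ _ (M%:R ^+ 4 * expR Lam * (tau * Lam) ^+ 3 * `|u| +
   tau * (M%:R ^+ 4 * expR Lam * (tau * Lam) ^+ 2 * `|N|))).
  apply: lerD; first apply: A1 => a aB.
    by rewrite mul1r; apply: le_trans (expR_taylor2 aB) _; rewrite ler_wpM2r.
  rewrite ler_pM2l //; apply: A2 => a aB; rewrite mul0r addr0.
  by apply: le_trans (phi1_taylor1 aB) _; rewrite ler_wpM2r.
rewrite -subr_ge0.
have -> : M%:R ^+ 4 * expR Lam * (Lam ^+ 3 + Lam ^+ 2) * tau ^+ 3 * (`|u| + `|N|) -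
    (M%:R ^+ 4 * expR Lam * (tau * Lam) ^+ 3 * `|u| +
     tau * (M%:R ^+ 4 * expR Lam * (tau * Lam) ^+ 2 * `|N|)) =
    M%:R ^+ 4 * expR Lam * tau ^+ 3 * (Lam ^+ 3 * `|N| + Lam ^+ 2 * `|u|).
  by ring.
apply: mulr_ge0; last by rewrite addr_ge0 // mulr_ge0 // exprn_ge0.
by rewrite !mulr_ge0 ?expR_ge0 ?exprn_ge0 // ltW.
Qed.

End Step.

(** * Uniform asymptotics and convergence of the midpoint method *)

Section Asymptotics.
Context {R : realType}.
Implicit Types U V W X Z : normedModType R.

Definition locLip U V (G : U -> V) : Prop :=
  forall B : R, exists K : R, forall x y, `|x| <= B -> `|y| <= B ->
    `|G x - G y| <= K * `|x - y|.

(** O(tau^n), uniformly over bounded sets of starting states. The restriction tau <= 1 lets a higher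
    order imply a lower one. *)
Definition unifO X V (n : nat) (p : X -> R -> V) : Prop :=
  forall B : R, exists K : R, forall x tau, `|x| <= B -> 0 < tau -> tau <= 1 ->
    `|p x tau| <= K * tau ^+ n.

Lemma locLipP U V (G : U -> V) : locLip G ->
  forall B, exists2 K, 0 <= K & forall x y, `|x| <= B -> `|y| <= B ->
    `|G x - G y| <= K * `|x - y|.
Proof.
move=> lipG B; have [K GK] := lipG B; exists `|K| => // x y xB yB.
by apply: le_trans (GK _ _ xB yB) _; rewrite ler_wpM2r // ler_norm.
Qed.

Lemma unifOP X V n (p : X -> R -> V) : unifO n p ->
  forall B, exists2 K, 0 <= K & forall x tau, `|x| <= B -> 0 < tau -> tau <= 1 ->
    `|p x tau| <= K * tau ^+ n.
Proof.
move=> pO B; have [K pK] := pO B; exists `|K| => // x tau xB t0 t1.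
apply: le_trans (pK _ _ xB t0 t1) _.
by rewrite ler_wpM2r ?ler_norm // exprn_ge0 // ltW.
Qed.

Lemma locLip_bounded U V (G : U -> V) : locLip G ->
  forall B, exists2 K, 0 <= K & forall x, `|x| <= B -> `|G x| <= K.
Proof.
move=> lipG B; have [K K0 GK] := locLipP lipG `|B|.
exists (K * `|B| + `|G 0|); first by rewrite addr_ge0 ?mulr_ge0.
move=> x xB; rewrite -[G x](subrK (G 0)); apply: le_trans (ler_normD _ _) _.
have xB' : `|x| <= `|B| by rewrite (le_trans xB) ?ler_norm.
rewrite lerD2r; apply: le_trans (GK x 0 xB' _) _; first by rewrite normr0.
by rewrite subr0 ler_wpM2l.
Qed.

Lemma locLip_cst U V (c : V) : locLip (fun _ : U => c).
Proof. by move=> B; exists 0 => x y _ _; rewrite subrr normr0 mul0r. Qed.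

Lemma locLip_comp U V W (G : V -> W) (H : U -> V) :
  locLip G -> locLip H -> locLip (fun x => G (H x)).
Proof.
move=> lipG lipH B; have [K1 K10 HK1] := locLip_bounded lipH B.
have [K2 K20 HK2] := locLipP lipH B; have [K3 K30 GK3] := locLipP lipG K1.
exists (K3 * K2) => x y xB yB; apply: le_trans (GK3 _ _ (HK1 _ xB) (HK1 _ yB)) _.
by rewrite -mulrA ler_wpM2l // HK2.
Qed.

Lemma locLipD U V (G H : U -> V) :
  locLip G -> locLip H -> locLip (fun x => G x + H x).
Proof.
move=> lipG lipH B; have [K1 GK] := lipG B; have [K2 HK] := lipH B.
exists (K1 + K2) => x y xB yB; rewrite opprD addrACA mulrDl.
by apply: le_trans (ler_normD _ _) _; rewrite lerD ?GK ?HK.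
Qed.

(** The bilinear map is kept abstract so that one product rule serves both scaling and [gdot]. *)
Lemma locLip_bilinear U V W Z (b : V -> W -> Z) (C : R) (G : U -> V) (H : U -> W) :
  (forall v v' w, b (v - v') w = b v w - b v' w) ->
  (forall v w w', b v (w - w') = b v w - b v w') ->
  0 <= C -> (forall v w, `|b v w| <= C * `|v| * `|w|) ->
  locLip G -> locLip H -> locLip (fun x => b (G x) (H x)).
Proof.
move=> bBl bBr C0 bC lipG lipH B.
have [K1 K10 GK1] := locLip_bounded lipG B; have [K2 K20 GK2] := locLipP lipG B.
have [K3 K30 HK3] := locLip_bounded lipH B; have [K4 K40 HK4] := locLipP lipH B.
exists (C * K1 * K4 + C * K2 * K3) => x y xB yB.
have -> : b (G x) (H x) - b (G y) (H y) = b (G x) (H x - H y) + b (G x - G y) (H y).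
  by rewrite bBl bBr addrA subrK.
apply: le_trans (ler_normD _ _) _.
have -> : (C * K1 * K4 + C * K2 * K3) * `|x - y| =
    C * (K1 * (K4 * `|x - y|)) + C * ((K2 * `|x - y|) * K3) by ring.
by apply: lerD; apply: le_trans (bC _ _) _; rewrite -mulrA; apply: ler_wpM2l => //;
  apply: ler_pM => //; auto.
Qed.

Lemma locLipZ U V (a : U -> R) (G : U -> V) :
  locLip a -> locLip G -> locLip (fun x => a x *: G x).
Proof.
apply: (@locLip_bilinear U R V V (fun a v => a *: v) 1) => // *.
- exact: scalerBl.
- exact: scalerBr.
- by rewrite normrZ mul1r.
Qed.

Lemma locLip_linear U V (A : {linear U -> V}) (K : R) :
  (forall x, `|A x| <= K * `|x|) -> locLip A.
Proof. by move=> AK B; exists K => x y _ _; rewrite -linearB. Qed.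

Lemma locLip_pair U V W (G : U -> V) (H : U -> W) :
  locLip G -> locLip H -> locLip (fun x => (G x, H x)).
Proof.
move=> lipG lipH B; have [K1 K10 GK] := locLipP lipG B.
have [K2 K20 HK] := locLipP lipH B.
exists (K1 + K2) => x y xB yB; rewrite prod_normE /= mulrDl ge_max.
apply/andP; split; [rewrite -[leLHS]addr0|rewrite -[leLHS]add0r].
  by rewrite lerD ?GK // mulr_ge0.
by rewrite lerD ?HK // mulr_ge0.
Qed.

Lemma locLip_fst U V : locLip (@fst U V).
Proof. by move=> B; exists 1 => x y _ _; rewrite mul1r prod_normE le_max lexx. Qed.

Lemma locLip_snd U V : locLip (@snd U V).
Proof. by move=> B; exists 1 => x y _ _; rewrite mul1r prod_normE le_max lexx orbT. Qed.

Lemma unifO_ext X V n (p q : X -> R -> V) :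
  (forall x tau, p x tau = q x tau) -> unifO n p -> unifO n q.
Proof.
move=> pq pO B; have [K pK] := pO B; exists K => x tau *; rewrite -pq.
exact: pK.
Qed.

Lemma unifOD X V n (p q : X -> R -> V) :
  unifO n p -> unifO n q -> unifO n (fun x tau => p x tau + q x tau).
Proof.
move=> pO qO B; have [K1 pK] := pO B; have [K2 qK] := qO B.
exists (K1 + K2) => x tau xB t0 t1; rewrite mulrDl.
by apply: le_trans (ler_normD _ _) _; rewrite lerD ?pK ?qK.
Qed.

Lemma unifON X V n (p : X -> R -> V) :
  unifO n p -> unifO n (fun x tau => - p x tau).
Proof.
by move=> pO B; have [K pK] := pO B; exists K => x tau *; rewrite normrN; exact: pK.
Qed.

Lemma unifOB X V n (p q : X -> R -> V) :
  unifO n p -> unifO n q -> unifO n (fun x tau => p x tau - q x tau).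
Proof. by move=> pO qO; apply: unifOD => //; apply: unifON. Qed.

Lemma unifO_subK X V n (p q : X -> R -> V) :
  unifO n (fun x tau => p x tau - q x tau) -> unifO n q -> unifO n p.
Proof.
by move=> pqO qO; apply: unifO_ext (unifOD pqO qO) => x tau; exact: subrK.
Qed.

Lemma unifO_bilinear X V W Z m n (b : V -> W -> Z) (C : R)
    (p : X -> R -> V) (q : X -> R -> W) :
  0 <= C -> (forall v w, `|b v w| <= C * `|v| * `|w|) ->
  unifO m p -> unifO n q -> unifO (m + n) (fun x tau => b (p x tau) (q x tau)).
Proof.
move=> C0 bC pO qO B; have [K1 K10 pK] := unifOP pO B.
have [K2 K20 qK] := unifOP qO B.
exists (C * (K1 * K2)) => x tau xB t0 t1; apply: le_trans (bC _ _) _.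
rewrite -mulrA -[leRHS]mulrA ler_wpM2l // exprD mulrACA.
by apply: ler_pM => //; auto.
Qed.

Lemma unifOZ X V m n (a : X -> R -> R) (p : X -> R -> V) :
  unifO m a -> unifO n p -> unifO (m + n) (fun x tau => a x tau *: p x tau).
Proof.
apply: (@unifO_bilinear X R V V m n (fun a v => a *: v) 1) => // *.
by rewrite normrZ mul1r.
Qed.

Lemma unifO_tau X : unifO 1 (fun (_ : X) (tau : R) => tau).
Proof. by move=> B; exists 1 => x tau _ t0 _; rewrite mul1r expr1 gtr0_norm. Qed.

Lemma unifO_cst X V (c : V) : unifO 0 (fun (_ : X) (_ : R) => c).
Proof. by move=> B; exists `|c| => x tau _ _ _; rewrite expr0 mulr1. Qed.

Lemma unifO_state X : unifO 0 (fun (x : X) (_ : R) => x).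
Proof. by move=> B; exists B => x tau xB _ _; rewrite expr0 mulr1. Qed.

Lemma unifO_weaken X V m n (p : X -> R -> V) : (m <= n)%N -> unifO n p -> unifO m p.
Proof.
move=> mn pO B; have [K K0 pK] := unifOP pO B; exists K => x tau xB t0 t1.
apply: le_trans (pK _ _ xB t0 t1) _; apply: ler_wpM2l => //.
by apply: ler_wiXn2l => //; exact: ltW.
Qed.

Lemma unifO_lip0 X U V (G : U -> V) (p : X -> R -> U) :
  locLip G -> unifO 0 p -> unifO 0 (fun x tau => G (p x tau)).
Proof.
move=> lipG pO B; have [K1 pK] := pO B.
have [K2 _ GK] := locLip_bounded lipG K1; exists K2 => x tau xB t0 t1.
by rewrite expr0 mulr1; apply: GK; have := pK x tau xB t0 t1; rewrite expr0 mulr1.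
Qed.

(** The two hypotheses of order 0 keep both arguments in one ball, where a single Lipschitz constant
    applies. *)
Lemma unifO_lip X U V n (G : U -> V) (p q : X -> R -> U) :
  locLip G -> unifO 0 p -> unifO 0 q -> unifO n (fun x tau => p x tau - q x tau) ->
  unifO n (fun x tau => G (p x tau) - G (q x tau)).
Proof.
move=> lipG pO qO pqO B; have [K1 pK] := pO B; have [K2 qK] := qO B.
have [K3 pqK] := pqO B.
have [K4 K40 GK] := locLipP lipG (Num.max K1 K2).
exists (K4 * K3) => x tau xB t0 t1.
apply: le_trans (GK _ _ _ _) _; last by rewrite -mulrA ler_wpM2l // pqK.
  by have := pK x tau xB t0 t1; rewrite expr0 mulr1 le_max => ->.
by have := qK x tau xB t0 t1; rewrite expr0 mulr1 le_max orbC => ->.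
Qed.

Lemma unifO_linear X U V n (A : U -> V) (K : R) (p : X -> R -> U) :
  0 <= K -> (forall x, `|A x| <= K * `|x|) -> unifO n p -> unifO n (fun x tau => A (p x tau)).
Proof.
move=> K0 AK pO B; have [K1 pK] := pO B; exists (K * K1) => x tau xB t0 t1.
by apply: le_trans (AK _) _; rewrite -mulrA ler_wpM2l // pK.
Qed.

Lemma unifO_pair X U V n (p : X -> R -> U) (q : X -> R -> V) :
  unifO n p -> unifO n q -> unifO n (fun x tau => (p x tau, q x tau)).
Proof.
move=> pO qO B; have [K1 pK] := pO B; have [K2 qK] := qO B.
exists (Num.max K1 K2) => x tau xB t0 t1; have t0n := exprn_gt0 n t0.
rewrite prod_normE ge_max /=; apply/andP; split.
  by apply: le_trans (pK _ _ xB t0 t1) _; rewrite ler_pM2r // le_max lexx.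
by apply: le_trans (qK _ _ xB t0 t1) _; rewrite ler_pM2r // le_max lexx orbT.
Qed.

(* As long as the error bound C tau ^ 2 is at most 1, the numerical solution stays in the
   unit neighbourhood of the trajectory, where G is Lipschitz. *)
Lemma midpoint_convergence X (G : X -> X) (Phi : R -> X -> X) (y : R -> X) (T By Ky : R) :
  locLip G ->
  unifO 3 (fun x tau => Phi tau x - (x + tau *: G (x + (tau / 2) *: G x))) ->
  0 < T -> (forall t, 0 <= t -> t <= T -> `|y t| <= By) ->
  (forall t tau, 0 <= t -> 0 < tau -> tau <= 1 -> t + tau <= T ->
    `|y (t + tau) - y t - tau *: G (y (t + tau / 2))| <= Ky * tau ^+ 3 /\
    `|y (t + tau / 2) - y t - (tau / 2) *: G (y t)| <= Ky * tau ^+ 2) ->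
  exists tau0 C : R, [/\ 0 < tau0, 0 < C & forall tau, 0 < tau -> tau <= tau0 ->
    forall n : nat, n%:R * tau <= T ->
      `|iter n (Phi tau) (y 0) - y (n%:R * tau)| <= C * tau ^+ 2].
Proof.
move=> lipG PhiO T0 yB yK.
have By0 : 0 <= By by apply: le_trans (yB 0 _ _); rewrite // ltW.
wlog Ky0 : Ky yK / 0 <= Ky.
  move=> H; apply: (H `|Ky|) => // t tau t0 tau0 tau1 tT.
  have [y1 y2] := yK t tau t0 tau0 tau1 tT.
  by split; [apply: le_trans y1 _|apply: le_trans y2 _];
    rewrite ler_wpM2r ?ler_norm ?exprn_ge0 // ltW.
(* [g] bounds the field on the unit neighbourhood of the trajectory; a half step from there has norm
   at most By + 1 + g, the radius used for the Lipschitz constant [K]. *)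
have [g g0 Gg] := locLip_bounded lipG (By + 1).
have [K K0 GK] := locLipP lipG (By + 1 + g).
have [K1 K10 PhiK] := unifOP PhiO (By + 1).
(* [D] adds up the local errors: scheme against midpoint step ([K1]), midpoint rule along y ([Ky]),
   inner stage ([K * Ky]). The midpoint step itself has Lipschitz constant 1 + Lam tau. *)
pose D := K1 + Ky + K * Ky; pose Lam := K + K ^+ 2.
have D0 : 0 <= D by rewrite !addr_ge0 ?mulr_ge0.
have Lam0 : 0 <= Lam by rewrite addr_ge0 ?sqr_ge0.
(* The summand 1 ensures C >= 1, so that tau <= C^-1 gives both tau <= 1 and C tau^2 <= 1. *)
pose C := D * T * expR (Lam * T) + 1.
have C1 : 1 <= C by rewrite lerDr !mulr_ge0 ?expR_ge0 // ltW.
have C0 : 0 < C by apply: lt_le_trans C1.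
exists C^-1, C; split; rewrite ?invr_gt0 // => tau tau0 tauC.
have tau1 : tau <= 1 by apply: le_trans tauC _; rewrite invf_le1.
have Ctau : C * tau ^+ 2 <= 1.
  rewrite expr2 mulrA -[leRHS]mul1r.
  apply: ler_pM => //; [by rewrite mulr_ge0 // ltW|exact: ltW|].
  by rewrite -(mulfV (lt0r_neq0 C0)) ler_pM2l.
pose Q x := x + tau *: G (x + (tau / 2) *: G x).
have half x : `|x| <= By + 1 -> `|x + (tau / 2) *: G x| <= By + 1 + g.
  move=> xB; apply: le_trans (ler_normD _ _) _; rewrite lerD // normrZ.
  rewrite gtr0_norm ?divr_gt0 // -[leRHS]mul1r ler_pM ?Gg //; lra.
have big (x : X) : `|x| <= By + 1 -> `|x| <= By + 1 + g.
  by move=> xB; rewrite (le_trans xB) // lerDl.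
have QLip x z : `|x| <= By + 1 -> `|z| <= By + 1 ->
    `|Q x - Q z| <= (1 + Lam * tau) * `|x - z|.
  move=> xB zB; rewrite /Q opprD addrACA -scalerBr.
  apply: le_trans (ler_normD _ _) _; rewrite normrZ gtr0_norm // [leRHS]mulrDl mul1r.
  rewrite lerD2l [Lam * tau]mulrC -[leRHS]mulrA ler_pM2l //.
  apply: le_trans (GK _ _ (half _ xB) (half _ zB)) _.
  have -> : Lam * `|x - z| = K * ((1 + K) * `|x - z|) by rewrite /Lam; ring.
  apply: ler_wpM2l => //.
  rewrite opprD addrACA -scalerBr; apply: le_trans (ler_normD _ _) _.
  rewrite mulrDl mul1r lerD2l normrZ gtr0_norm ?divr_gt0 //.
  apply: (@le_trans _ _ (1 * `|G x - G z|)); last by rewrite mul1r GK // big.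
  by rewrite ler_wpM2r //; lra.
have local x t : `|x| <= By + 1 -> 0 <= t -> t + tau <= T ->
    `|Phi tau x - y (t + tau)| <= (1 + Lam * tau) * `|x - y t| + D * tau ^+ 3.
  move=> xB t0 tT; have [y1 y2] := yK t tau t0 tau0 tau1 tT.
  have yB1 s : 0 <= s -> s <= T -> `|y s| <= By + 1.
    by move=> s0 sT; rewrite (le_trans (yB s s0 sT)) // lerDl.
  have yt : `|y t| <= By + 1 by apply: yB1 => //; lra.
  have yh : `|y (t + tau / 2)| <= By + 1 by apply: yB1; lra.
  (* Telescoping through the midpoint steps from x and from y t; the last term compares G at the
     true midpoint with G at the Euler half step. *)
  have -> : Phi tau x - y (t + tau) = (Phi tau x - Q x) + (Q x - Q (y t)) -
      (y (t + tau) - y t - tau *: G (y (t + tau / 2))) -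
      tau *: (G (y (t + tau / 2)) - G (y t + (tau / 2) *: G (y t))).
    rewrite scalerBr -[RHS]addrA -opprD (addrA (_ - y t - _)) subrK -[_ - y t - _]addrA.
    by rewrite -opprD -/(Q (y t)) opprB (addrA (_ - Q x)) subrK addrA subrK.
  have y3 : `|tau *: (G (y (t + tau / 2)) - G (y t + (tau / 2) *: G (y t)))|
      <= K * Ky * tau ^+ 3.
    rewrite normrZ gtr0_norm // [tau ^+ 3]exprS mulrCA ler_pM2l // -mulrA.
    have := GK _ _ (big _ yh) (half _ yt); move=> /le_trans; apply.
    by apply: ler_wpM2l => //; rewrite opprD addrA.
  apply: le_trans (ler_normB _ _) _; apply: le_trans (lerD (ler_normB _ _) y3) _.
  apply: le_trans (lerD (lerD (ler_normD _ _) y1) (lexx _)) _.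
  have := PhiK _ _ xB tau0 tau1; have := QLip _ _ xB yt.
  rewrite -/(Q x) /D; lra.
(* Majorant of the recursion e_(n+1) <= (1 + Lam tau) e_n + D tau^3 with e_0 = 0; the bound n tau <=
   T then converts n tau^3 into T tau^2. *)
pose err n := D * tau ^+ 3 * n%:R * expR (Lam * (n%:R * tau)).
have err_le n : n%:R * tau <= T -> err n <= C * tau ^+ 2.
  move=> nT; have t2 : 0 <= tau ^+ 2 by rewrite sqr_ge0.
  have -> : err n = D * (n%:R * tau) * expR (Lam * (n%:R * tau)) * tau ^+ 2.
    by rewrite /err; ring.
  apply: ler_wpM2r => //; apply: (@le_trans _ _ (D * T * expR (Lam * T))); last first.
    by rewrite lerDl.
  have ntau0 : 0 <= n%:R * tau by rewrite mulr_ge0 // ltW.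
  apply: ler_pM; rewrite ?expR_ge0 ?ler_expR //; first by rewrite mulr_ge0.
    exact: ler_wpM2l.
  exact: ler_wpM2l.
suff bound n : n%:R * tau <= T -> `|iter n (Phi tau) (y 0) - y (n%:R * tau)| <= err n.
  by move=> n nT; apply: le_trans (bound n nT) (err_le n nT).
elim: n => [_|n IH nT].
  by rewrite mul0r subrr normr0 /err mulr0 mul0r.
have nS : n.+1%:R * tau = n%:R * tau + tau by rewrite -natr1 mulrDl mul1r.
have ntau0 : 0 <= n%:R * tau by rewrite mulr_ge0 // ltW.
have nT' : n%:R * tau <= T by rewrite (le_trans _ nT) // nS lerDl ltW.
have {}IH := IH nT'.
set x := iter n (Phi tau) (y 0) in IH *.
have xB : `|x| <= By + 1.
  rewrite -[x](subrK (y (n%:R * tau))) addrC; apply: le_trans (ler_normD _ _) _.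
  by apply: lerD; [exact: yB|exact: le_trans IH (le_trans (err_le n nT') Ctau)].
rewrite iterS -/x nS; apply: le_trans (local _ _ xB ntau0 _) _; first by rewrite -nS.
have LT0 : 0 <= Lam * tau by rewrite mulr_ge0 // ltW.
apply: (@le_trans _ _ ((1 + Lam * tau) * err n + D * tau ^+ 3)).
  by rewrite lerD2r ler_wpM2l // addr_ge0.
rewrite /err nS mulrDr expRD -natr1.
set E := expR (Lam * (n%:R * tau)); set e1 := expR (Lam * tau).
have E1 : 1 <= E by rewrite -expR0 ler_expR mulr_ge0.
have e11 : 1 + Lam * tau <= e1 by exact: expR_ge1Dx.
have Dt : 0 <= D * tau ^+ 3 by rewrite mulr_ge0 // exprn_ge0 // ltW.
have -> : D * tau ^+ 3 * (n%:R + 1) * (E * e1) =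
    e1 * (D * tau ^+ 3 * n%:R * E) + D * tau ^+ 3 * (E * e1) by ring.
apply: lerD; first by rewrite ler_wpM2r // mulr_ge0 ?expR_ge0 // mulr_ge0.
by rewrite -[leLHS]mulr1 ler_wpM2l // -[1]mulr1 ler_pM //; lra.
Qed.

End Asymptotics.

(** * One step of the scheme *)

Section ScalarLipschitz.
Context {R : realType}.

Lemma continuous_segment_bounded (p : R -> R) (a b : R) :
  {within `[a, b], continuous p} ->
  exists2 K, 0 <= K & forall t, a <= t -> t <= b -> `|p t| <= K.
Proof.
move=> cp; have [ba|ab] := ltP b a.
  exists 0 => // t at_ tb; have := le_lt_trans (le_trans at_ tb) ba.
  by rewrite ltxx.
have [c1 _ c1P] := EVT_max ab cp; have [c2 _ c2P] := EVT_min ab cp.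
exists (`|p c1| + `|p c2|) => [|t at_ tb]; first by rewrite addr_ge0.
have tab : t \in `[a, b] by rewrite in_itv /= at_ tb.
have := c1P t tab; have := c2P t tab; rewrite ler_norml.
have := ler_norm (p c1); have := ler_norm (- p c2); rewrite normrN => ? ? ? ?.
have := normr_ge0 (p c1); have := normr_ge0 (p c2) => ? ?.
by apply/andP; split; lra.
Qed.

Lemma derive_locLip (p dp : R -> R) :
  (forall x : R, is_derive x 1 p (dp x)) -> continuous dp -> locLip p.
Proof.
move=> dpE cdp B.
have cdpB : {within `[- B, B], continuous dp} := continuous_subspaceT cdp.
have [K K0 dpK] := continuous_segment_bounded cdpB.
have le_case x y : `|x| <= B -> `|y| <= B -> x <= y -> `|p y - p x| <= K * `|y - x|.
  rewrite (ler_norml x) (ler_norml y) => /andP[? ?] /andP[? ?] xy.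
  rewrite (ger0_norm (x := y - x)) ?subr_ge0 //.
  apply: (@mean_value_le _ p dp) => // [|z /andP[? ?]].
    exact: is_derive_within_continuous dpE.
  by apply: dpK; lra.
exists K => x y xB yB; have [xy|/ltW yx] := leP x y; last exact: le_case.
by rewrite distrC [X in K * X]distrC; exact: le_case.
Qed.

Lemma C1_locLip (p : R -> R) : C1 p -> locLip p.
Proof.
move=> [dp cdp]; apply: derive_locLip cdp => x.
by rewrite derive1E; exact: derivableP.
Qed.

(** On a bounded set of arguments the continuous positive p has a positive minimum; this keeps the
    denominator of g away from 0. *)
Lemma locLip_inv (U : normedModType R) (p : R -> R) (G : U -> R) :
  continuous p -> (forall x, 0 < p x) -> locLip p -> locLip G ->
  locLip (fun x => (p (G x))^-1).
Proof.
move=> cp p0 lipp lipG; apply: (locLip_comp (G := fun r => (p r)^-1)) lipG => B.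
have [B0|B0] := ltP B 0.
  exists 0 => x y xB; have := le_lt_trans (le_trans (normr_ge0 x) xB) B0.
  by rewrite ltxx.
have BB : - B <= B by rewrite (le_trans _ B0) // oppr_le0.
have [c _ cP] := EVT_min BB (continuous_subspaceT cp).
have [K K0 pK] := locLipP lipp B.
have pc x : `|x| <= B -> (p x)^-1 <= (p c)^-1.
  by move=> xB; rewrite lef_pV2 ?posrE // cP // in_itv /= -ler_norml.
exists (K * ((p c)^-1 * (p c)^-1)) => x y xB yB.
have -> : (p x)^-1 - (p y)^-1 = (p y - p x) * ((p x)^-1 * (p y)^-1).
  by field; rewrite !gt_eqF.
rewrite normrM distrC mulrAC; apply: ler_pM => //; first exact: pK.
have pV z : 0 <= (p z)^-1 by rewrite invr_ge0 ltW.
by rewrite ger0_norm ?mulr_ge0 // ler_pM // pc.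
Qed.

End ScalarLipschitz.

(** * The extended vector field, and the scheme as a perturbed midpoint step *)

Section GsavField.
Context {R : realType} {M : nat} (h eps : R) (f F sigma : R -> R).
Notation X := (grid R M * R)%type.

(* The scheme discretizes the extended system (u, s)' = gsav_field (u, s). *)
Definition gsav_du (x : X) : grid R M :=
  eps ^+ 2 *: glap h x.1 + gfun h F sigma x.1 x.2 *: map_mx f x.1.

Definition gsav_field (x : X) : X :=
  (gsav_du x, - gfun h F sigma x.1 x.2 * gdot h (map_mx f x.1) (gsav_du x)).

Lemma locLip_map_mx (p : R -> R) : locLip p -> locLip (map_mx p : grid R M -> grid R M).
Proof.
move=> lipp B; have [K K0 pK] := locLipP lipp B; exists K => v w vB wB.
apply/mx_norm_leP => [|i j]; first by rewrite mulr_ge0.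
have le_B (z : grid R M) : `|z| <= B -> `|z i j| <= B.
  exact: le_trans (entry_le_mx_norm z i j).
rewrite !mxE; apply: le_trans (pK _ _ (le_B _ vB) (le_B _ wB)) _.
by apply: ler_wpM2l => //; have := entry_le_mx_norm (v - w) i j; rewrite !mxE.
Qed.

Lemma gdot_const_ge0 : 0 <= h ^+ 2 * M%:R ^+ 2.
Proof. by rewrite mulr_ge0 ?sqr_ge0. Qed.

Lemma locLip_gdot (U : normedModType R) (p q : U -> grid R M) :
  locLip p -> locLip q -> locLip (fun x => gdot h (p x) (q x)).
Proof.
apply: (@locLip_bilinear R U _ _ _ (gdot h) (h ^+ 2 * M%:R ^+ 2)).
- exact: gdotBl.
- exact: gdotBr.
- exact: gdot_const_ge0.
- exact: gdot_norm_le.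
Qed.

Lemma locLip_E1h : locLip F -> locLip (@E1h R M h F).
Proof.
move=> lipF; apply: locLip_gdot; first exact: locLip_map_mx.
exact: locLip_cst.
Qed.

Hypotheses (lipf : locLip f) (lipF : locLip F) (lips : locLip sigma).
Hypotheses (sigma_cont : continuous sigma) (sigma_gt0 : forall x, 0 < sigma x).

Lemma locLip_gfun : locLip (fun x : X => gfun h F sigma x.1 x.2).
Proof.
apply: (@locLipZ R _ _ (fun x : X => sigma x.2) (fun x : X => (sigma (E1h h F x.1))^-1)).
  by apply: locLip_comp => //; exact: locLip_snd.
apply: locLip_inv => //; apply: locLip_comp; first exact: locLip_E1h.
exact: locLip_fst.
Qed.

Lemma locLip_gsav_du : locLip gsav_du.
Proof.
apply: locLipD.
  apply: locLipZ; first exact: locLip_cst.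
  apply: (locLip_comp (G := @glap R M h)); last exact: locLip_fst.
  exact: (@locLip_linear _ _ _ (@glap R M h) _ (glap_norm_le h)).
apply: locLipZ; first exact: locLip_gfun.
by apply: locLip_comp (@locLip_fst _ _ _); exact: locLip_map_mx.
Qed.

Lemma locLip_gsav_field : locLip gsav_field.
Proof.
apply: locLip_pair; first exact: locLip_gsav_du.
apply: locLipZ.
  rewrite (_ : (fun x : X => _) = fun x : X => (-1) *: gfun h F sigma x.1 x.2); last first.
    by apply/funext => x; rewrite scaleN1r.
  by apply: locLipZ; [exact: locLip_cst|exact: locLip_gfun].
apply: locLip_gdot; last exact: locLip_gsav_du.
by apply: locLip_comp (@locLip_fst _ _ _); exact: locLip_map_mx.
Qed.

Variable kappa : R.
Hypothesis h_gt0 : 0 < h.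

Lemma unifO_gdot m n (p q : X -> R -> grid R M) : unifO m p -> unifO n q ->
  unifO (m + n) (fun x tau => gdot h (p x tau) (q x tau)).
Proof. exact: unifO_bilinear gdot_const_ge0 (@gdot_norm_le _ _ h). Qed.

Lemma unifO_Lop n (c : X -> R -> R) (p : X -> R -> grid R M) :
  unifO 0 c -> unifO n p -> unifO n (fun x tau => Lop h eps kappa (c x tau) (p x tau)).
Proof.
move=> cO pO; apply: unifOB.
  apply: (@unifOZ _ _ _ 0) => //; apply: (@unifOZ _ _ _ 0 0) => //.
  exact: unifO_cst.
apply: (@unifOZ _ _ _ 0); first exact: unifO_cst.
apply: (unifO_linear _ (glap_norm_le h)) pO.
by rewrite mulr_ge0 // invr_ge0 sqr_ge0.
Qed.

Lemma unifO_ei_update (c r : X -> R -> R) (u v k : X -> R -> grid R M) :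
  unifO 0 c -> unifO 0 u -> unifO 0 v -> unifO 0 r ->
  (forall x tau, k x tau =
     Nop h kappa f F sigma (c x tau) (v x tau) (r x tau) - Lop h eps kappa (c x tau) (u x tau)) ->
  unifO 3 (fun x tau =>
    ei_update h eps kappa f F sigma tau (c x tau) (u x tau) (v x tau) (r x tau)
    - (u x tau + tau *: k x tau - (tau ^+ 2 / 2) *: Lop h eps kappa (c x tau) (k x tau))).
Proof.
move=> cO uO vO rO kE B.
have NO : unifO 0 (fun x tau => Nop h kappa f F sigma (c x tau) (v x tau) (r x tau)).
  apply: unifOD.
    apply: (@unifOZ _ _ _ 0 0).
      apply: (unifO_lip0 (p := fun x tau => (v x tau, r x tau)) locLip_gfun).
      exact: unifO_pair.
    exact: (unifO_lip0 (locLip_map_mx lipf)).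
  apply: (@unifOZ _ _ _ 0 0) => //; apply: (@unifOZ _ _ _ 0 0) => //.
  exact: unifO_cst.
have [K1 cK] := cO B; have [K2 K20 uK] := unifOP uO B; have [K3 K30 NK] := unifOP NO B.
have [K K0 eiK] := @ei_update_expansion R M h eps kappa f F sigma h_gt0 K1.
exists (K * (K2 + K3)) => x tau xB t0 t1.
have cx : `|c x tau| <= K1 by have := cK x tau xB t0 t1; rewrite expr0 mulr1.
apply: le_trans (eiK _ _ _ _ _ t0 t1 cx _ _ erefl (kE x tau)) _.
rewrite mulrAC; apply: ler_wpM2r; first by rewrite exprn_ge0 // ltW.
apply: ler_wpM2l => //; have := uK x tau xB t0 t1; have := NK x tau xB t0 t1.
by rewrite expr0 !mulr1 => ? ?; exact: lerD.
Qed.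

(** The predictor is needed only to O(tau^2): it enters the corrector through a field multiplied by
    tau, and the scalar update through a product with u' - u = O(tau). *)
Lemma gsav_ei2_step_midpoint :
  unifO 3 (fun (x : X) tau => gsav_ei2_step h eps kappa f F sigma tau x
    - (x + tau *: gsav_field (x + (tau / 2) *: gsav_field x))).
Proof.
pose c (x : X) (tau : R) := gfun h F sigma x.1 x.2.
pose u (x : X) (tau : R) := x.1.
pose s (x : X) (tau : R) := x.2.
pose k1 (x : X) (tau : R) := gsav_du x.
pose up x tau := ei_update h eps kappa f F sigma tau (c x tau) (u x tau) (u x tau) (s x tau).
pose sp x tau := s x tau - c x tau * gdot h (map_mx f (u x tau)) (up x tau - u x tau).
pose xh x tau : X := (2^-1 *: (u x tau + up x tau), 2^-1 * (s x tau + sp x tau)).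
pose ch x tau := gfun h F sigma (xh x tau).1 (xh x tau).2.
pose k2 x tau := Nop h kappa f F sigma (ch x tau) (xh x tau).1 (xh x tau).2
  - Lop h eps kappa (ch x tau) (u x tau).
pose u' x tau := ei_update h eps kappa f F sigma tau (ch x tau) (u x tau)
  (xh x tau).1 (xh x tau).2.
pose s' x tau := s x tau - ch x tau * gdot h (map_mx f (xh x tau).1) (u' x tau - u x tau)
  + kappa / 2 * ch x tau * gdot h (u' x tau - up x tau) (u' x tau - u x tau).
have tau1 := @unifO_tau R X.
have tau2 : unifO 2 (fun (_ : X) tau => tau ^+ 2 / 2).
  apply: (@unifOZ _ _ R 2 0 (fun _ tau => tau ^+ 2)) (@unifO_cst _ _ _ _).
  exact: (@unifOZ _ _ R 1 1 (fun _ tau => tau) (fun _ tau => tau)).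
have tauh : unifO 1 (fun (_ : X) tau => tau / 2).
  by apply: (@unifOZ _ _ R 1 0 (fun _ tau => tau)) => //; exact: unifO_cst.
have uO : unifO 0 u by apply: (unifO_lip0 (@locLip_fst _ _ _)); exact: unifO_state.
have sO : unifO 0 s by apply: (unifO_lip0 (@locLip_snd _ _ _)); exact: unifO_state.
have cO : unifO 0 c by apply: (unifO_lip0 locLip_gfun); exact: unifO_state.
have k1O : unifO 0 k1 by apply: (unifO_lip0 locLip_gsav_du); exact: unifO_state.
have fuO : unifO 0 (fun x tau => map_mx f (u x tau)).
  exact: (unifO_lip0 (locLip_map_mx lipf)).
have k1E x tau : k1 x tau = Nop h kappa f F sigma (c x tau) (u x tau) (s x tau)
    - Lop h eps kappa (c x tau) (u x tau).
  by rewrite /k1 /gsav_du /Nop /Lop opprB addrACA subrr addr0 addrC.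
have LO := unifO_Lop.
(* The term tau^2/2 L k1 of the expansion is counted as remainder here. *)
have upO2 : unifO 2 (fun x tau => up x tau - (u x tau + tau *: k1 x tau)).
  have upO3 := unifO_ei_update cO uO uO sO k1E.
  apply: unifO_ext (unifOB (unifO_weaken _ upO3) (unifOZ tau2 (LO _ _ _ cO k1O))) => // x tau.
  by rewrite -/(up x tau) opprB addrCA [LHS]addrC addKr.
have ukO : unifO 0 (fun x tau => u x tau + tau *: k1 x tau).
  by apply: unifOD => //; apply: unifO_weaken (unifOZ tau1 k1O).
have upO : unifO 0 up by apply: unifO_subK ukO; apply: unifO_weaken upO2.
have spO2 : unifO 2 (fun x tau => sp x tau - (s x tau + tau *: (gsav_field x).2)).
  apply: unifO_ext (unifON (unifOZ cO (unifO_gdot fuO upO2))) => x tau.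
  rewrite /sp /= -/(c x tau) -/(u x tau) -/(k1 x tau) !gdotBr gdotDr gdotZr /GRing.scale /=.
  ring.
have GO : unifO 0 (fun (x : X) (tau : R) => gsav_field x).
  by apply: (unifO_lip0 locLip_gsav_field); exact: unifO_state.
have xhO2 : unifO 2 (fun x tau => xh x tau - (x + (tau / 2) *: gsav_field x)).
  have halfO := @unifO_cst _ X R (2^-1).
  apply: unifO_ext (unifO_pair (unifOZ halfO upO2) (unifOZ halfO spO2)) => x tau.
  rewrite /xh /k1 /u /s -[gsav_du x]/((gsav_field x).1).
  move: (up x tau) (sp x tau) (gsav_field x) => a b [G1 G2]; case: x => u0 s0.
  apply: injective_projections; rewrite /= /GRing.scale /=; last by field.
  by apply/matrixP => i j; rewrite !mxE; field.
have GhO : unifO 0 (fun x tau => x + (tau / 2) *: gsav_field x).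
  by apply: unifOD; [exact: unifO_state|apply: unifO_weaken (unifOZ tauh GO)].
have xhO : unifO 0 xh by apply: unifO_subK GhO; apply: unifO_weaken xhO2.
have chO : unifO 0 ch by apply: unifO_lip0 locLip_gfun xhO.
have uhO : unifO 0 (fun x tau => (xh x tau).1) by apply: unifO_lip0 (@locLip_fst _ _ _) xhO.
have shO : unifO 0 (fun x tau => (xh x tau).2) by apply: unifO_lip0 (@locLip_snd _ _ _) xhO.
have fuhO : unifO 0 (fun x tau => map_mx f (xh x tau).1).
  exact: (unifO_lip0 (locLip_map_mx lipf)).
have duhO : unifO 0 (fun x tau => gsav_du (xh x tau)) by apply: unifO_lip0 locLip_gsav_du xhO.
have uhuO2 : unifO 2 (fun x tau => (xh x tau).1 - (u x tau + (tau / 2) *: k1 x tau)).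
  by apply: unifO_lip xhO2; [exact: locLip_fst|exact: xhO|exact: GhO].
have uhuO1 : unifO 1 (fun x tau => (xh x tau).1 - u x tau).
  apply: unifO_ext (unifOD (unifO_weaken _ uhuO2) (unifOZ tauh k1O)) => // x tau.
  by rewrite opprD addrA subrK.
have du1 : unifO 1 (fun x tau => gsav_du (xh x tau) - k1 x tau).
  apply: unifO_lip locLip_gsav_du xhO _ _; first exact: unifO_state.
  apply: unifO_ext (unifOD (unifO_weaken _ xhO2) (unifOZ tauh GO)) => // x tau.
  by rewrite opprD addrA subrK.
(* The corrector has N at the predicted midpoint but L at u; its slope differs from the field by
   exactly L (uh - u). *)
have k2E x tau : k2 x tau - gsav_du (xh x tau) =
    Lop h eps kappa (ch x tau) ((xh x tau).1 - u x tau).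
  rewrite /k2 /gsav_du /Nop -/(ch x tau) /Lop (linearB (@glap R M h)) /=.
  move: (u x tau) (2^-1 *: _) (ch x tau) (glap h _) (glap h (u x tau)) (map_mx f _).
  by move=> w v c0 lv lw fv; apply/matrixP => i j; rewrite !mxE; ring.
have k2O1 : unifO 1 (fun x tau => k2 x tau - gsav_du (xh x tau)).
  by apply: unifO_ext (LO _ _ _ chO uhuO1) => x tau; rewrite k2E.
have k2O : unifO 0 k2 by apply: unifO_subK duhO; apply: unifO_weaken k2O1.
have u'O3 : unifO 3 (fun x tau => u' x tau - (u x tau + tau *: gsav_du (xh x tau))).
  have u'1 := unifO_ei_update chO uO uhO shO (k := k2) (fun x tau => erefl).
  (* With uh - u = tau/2 k2 + O(tau^2), the term tau L (uh - u) cancels tau^2/2 L k2 up to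
     O(tau^3). *)
  have d2 : unifO 2 (fun x tau => (xh x tau).1 - u x tau - (tau / 2) *: k2 x tau).
    have k12 : unifO 1 (fun x tau => k1 x tau - k2 x tau).
      apply: unifO_ext (unifON (unifOD k2O1 du1)) => x tau.
      by rewrite addrA subrK opprB.
    apply: unifO_ext (unifOD uhuO2 (unifOZ tauh k12)) => x tau.
    by rewrite scalerBr opprD !addrA subrK.
  apply: unifO_ext (unifOD u'1 (unifOZ tau1 (LO _ _ _ chO d2))) => x tau.
  rewrite -/(u' x tau) [(xh x tau).1 - _ - _]addrC.
  rewrite -(scaleNr (tau / 2) (k2 x tau)) (Lop_linear h eps kappa (ch x tau)) -k2E.
  move: (u' x tau) (u x tau) (k2 x tau) (gsav_du _) (Lop _ _ _ _ _) => a b c0 d e.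
  by apply/matrixP => i j; rewrite !mxE; field.
have u'uO1 : unifO 1 (fun x tau => u' x tau - u x tau).
  apply: unifO_ext (unifOD (unifO_weaken _ u'O3) (unifOZ tau1 duhO)) => // x tau.
  by rewrite opprD addrA subrK.
(* Corrector and predictor agree to O(tau^2), so the [kappa] term of s' is a product of orders 2 and
   1. *)
have u'upO2 : unifO 2 (fun x tau => u' x tau - up x tau).
  apply: unifO_ext (unifOD (unifOB (unifO_weaken _ u'O3) upO2) (unifOZ tau1 du1)) => // x tau.
  move: (u' x tau) (up x tau) (u x tau) (k1 x tau) (gsav_du _) => a b c0 d e.
  by apply/matrixP => i j; rewrite !mxE; ring.
have s'O3 : unifO 3 (fun x tau => s' x tau - (s x tau + tau *: (gsav_field (xh x tau)).2)).
  have kO := @unifO_cst _ X R (kappa / 2).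
  apply: unifO_ext (unifOB (unifOZ (unifOZ kO chO) (unifO_gdot u'upO2 u'uO1))
    (unifOZ chO (unifO_gdot fuhO u'O3))) => x tau.
  rewrite /s' /= -/(ch x tau) !gdotBr gdotDr gdotZr /GRing.scale /=.
  ring.
have fieldO2 : unifO 2 (fun x tau => gsav_field (xh x tau)
    - gsav_field (x + (tau / 2) *: gsav_field x)).
  exact: unifO_lip locLip_gsav_field xhO GhO xhO2.
apply: unifO_ext (unifOD (unifO_pair u'O3 s'O3) (unifOZ tau1 fieldO2)) => x tau.
have -> : gsav_ei2_step h eps kappa f F sigma tau x = (u' x tau, s' x tau) by case: x.
rewrite -[gsav_du _]/((gsav_field (xh x tau)).1) /u /s.
move: (u' x tau) (s' x tau) (gsav_field (xh x tau)) (gsav_field _) => a b [a1 b1] [a2 b2].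
case: x => u0 s0; apply: injective_projections; rewrite /= /GRing.scale /=; last by ring.
by apply/matrixP => i j; rewrite !mxE; ring.
Qed.

End GsavField.

(** * The midpoint rule along the exact solution *)

Section DerivativesOnSegment.
Context {R : realType}.

Lemma has_deriv_in_interior (V : normedModType R) (D : set R) (w : R -> V) t l :
  nbhs t D -> has_deriv_in D w t l ->
  (s - t)^-1 *: (w s - w t) @[s --> t^'] --> l.
Proof.
move=> tD wl A /wl; rewrite /nbhs /= /within /= /nbhs /= => wA.
by apply: filterS2 wA (nbhs_dnbhs tD) => s; exact.
Qed.

Lemma is_derive_quotient (p : R -> R) (t l : R) :
  (s - t)^-1 *: (p s - p t) @[s --> t^'] --> l -> is_derive t 1 p l.
Proof.
move=> pl; have pl' : h^-1 *: ((p \o shift t) (h *: 1) - p t) @[h --> 0^'] --> l.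
  apply/cvgrPdist_lt => e e0; move/cvgrPdist_lt/(_ e e0): pl.
  rewrite !near_withinE => /nbhs_ballP [d /= d0 dP].
  apply/nbhs_ballP; exists d => //= x; rewrite /ball /= sub0r normrN => xd x0.
  have := dP (x + t); rewrite /ball /= opprD addrCA subrr addr0 normrN => /(_ xd).
  have xt : x + t != t by rewrite -subr_eq0 addrK.
  by move=> /(_ xt); rewrite addrK /GRing.scale /= mulr1.
by apply: DeriveDef; [apply/cvg_ex; exists l|exact: cvg_lim].
Qed.

Lemma is_derive_entry (M : nat) (D : set R) (w : R -> grid R M) t l i j :
  nbhs t D -> has_deriv_in D w t l -> is_derive t 1 (fun s => w s i j) (l i j).
Proof.
move=> tD /(has_deriv_in_interior tD) wl; apply: is_derive_quotient.
have := continuous_cvg _ (@coord_continuous R M M i j l) wl.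
rewrite (_ : _ \o _ = fun s => (s - t)^-1 *: (w s i j - w t i j)); first exact.
by apply/funext => s /=; rewrite !mxE.
Qed.

Variable T : R.
Notation D := `[0, T]%classic.

Lemma nbhs_segment t : 0 < t -> t < T -> nbhs t D.
Proof.
move=> t0 tT; apply: (@filterS _ _ _ `]0, T[%classic).
  by move=> s /=; rewrite !in_itv /= => /andP[? ?]; rewrite !ltW.
by apply: open_nbhs_nbhs; split; [exact: interval_open|rewrite /= in_itv /= t0].
Qed.

(** These are the hypotheses of the mean value theorem: two-sided derivatives in the open interval
    and continuity up to the endpoints, hence no one-sided derivatives. *)
Definition diff_on (p dp : R -> R) : Prop :=
  {within D, continuous p} /\
  forall t : R, 0 < t -> t < T -> is_derive t 1 p (dp t).

Lemma diff_onB (p dp q dq : R -> R) : diff_on p dp ->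
  (forall x : R, is_derive x 1 q (dq x)) ->
  diff_on (fun x => p x - q x) (fun x => dp x - dq x).
Proof.
move=> [cp dpE] dqE; split=> [|x x0 xT].
  exact: (within_continuousB cp (is_derive_within_continuous dqE)).
exact: is_deriveB (dpE x x0 xT) (dqE x).
Qed.

(** Only points at least as close to t as s is are tested, on either side of t; nested uses thus
    produce powers of |s - t|. *)
Lemma mean_value_on (p dp : R -> R) (s t K : R) : diff_on p dp ->
  0 <= s <= T -> 0 <= t <= T ->
  (forall x, 0 < x < T -> `|x - t| <= `|s - t| -> `|dp x| <= K) ->
  `|p s - p t| <= K * `|s - t|.
Proof.
move=> [cp dpE].
have aux a b K' : 0 <= a -> a <= b -> b <= T ->
    (forall x, a < x < b -> `|dp x| <= K') -> `|p b - p a| <= K' * (b - a).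
  move=> a0 ab bT dpK; apply: (@mean_value_le _ p dp) => // [x /andP[ax xb]|].
    by apply: dpE; lra.
  apply: continuous_subspaceW cp => x /=; rewrite !in_itv /= => /andP[? ?].
  by apply/andP; split; lra.
move=> /andP[s0 sT] /andP[t0 tT] dpK; have [ts|/ltW st] := leP t s.
  rewrite [X in _ * X]ger0_norm ?subr_ge0 //; apply: aux => // x /andP[? ?].
  by apply: dpK; [lra|rewrite !ger0_norm; lra].
rewrite distrC [X in _ * X]distrC [X in _ * X]ger0_norm ?subr_ge0 //.
apply: aux => // x /andP[? ?].
by apply: dpK; [lra|rewrite !ler0_norm; lra].
Qed.

(** A substitute for C^1 with Lipschitz derivative, p1 playing the role of p'. Stated as an
    inequality for all pairs, endpoints included, it is stable under products by pure algebra. *)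
Definition taylor1_on (p p1 : R -> R) (K : R) : Prop :=
  forall s t, 0 <= s <= T -> 0 <= t <= T ->
  [/\ `|p t| <= K, `|p1 t| <= K & `|p s - p t - (s - t) * p1 t| <= K * (s - t) ^+ 2].

Definition smooth_on (p : R -> R) : Prop := exists p1 K, taylor1_on p p1 K.

Lemma smooth_cst (c : R) : smooth_on (fun=> c).
Proof.
exists (fun=> 0), `|c| => s t _ _; split=> //; first by rewrite normr0.
by rewrite mulr0 subr0 subrr normr0 mulr_ge0 ?sqr_ge0.
Qed.

Lemma smoothD p q : smooth_on p -> smooth_on q -> smooth_on (fun t => p t + q t).
Proof.
move=> [p1 [K pK]] [q1 [L qL]]; exists (fun t => p1 t + q1 t), (K + L) => s t sT tT.
have [pt p1t pst] := pK s t sT tT; have [qt q1t qst] := qL s t sT tT.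
split; try by apply: le_trans (ler_normD _ _) _; exact: lerD.
rewrite [leRHS]mulrDl (_ : _ - _ - _ = (p s - p t - (s - t) * p1 t)
  + (q s - q t - (s - t) * q1 t)); last by ring.
by apply: le_trans (ler_normD _ _) _; exact: lerD.
Qed.

Lemma smoothM p q : smooth_on p -> smooth_on q -> smooth_on (fun t => p t * q t).
Proof.
move=> [p1 [K pK]] [q1 [L qL]].
(* The remainder of the product splits into three terms of size K L (s - t)^2 and one of third order
   in s - t, where |s - t| <= T yields the factor |T|. *)
exists (fun t => p1 t * q t + p t * q1 t), (K * L * (3 + `|T|)) => s t sT tT.
have [pt p1t pst] := pK s t sT tT; have [qt q1t qst] := qL s t sT tT.
have [qs _ _] := qL t s tT sT.
have K0 : 0 <= K := le_trans (normr_ge0 _) pt.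
have L0 : 0 <= L := le_trans (normr_ge0 _) qt.
have KL0 : 0 <= K * L by rewrite mulr_ge0.
have KL x y : `|x| <= K -> `|y| <= L -> `|x * y| <= K * L.
  by move=> xK yL; rewrite normrM ler_pM.
have T0 := normr_ge0 T.
have le_const a : a <= 3 -> K * L * a <= K * L * (3 + `|T|).
  by move=> a3; apply: ler_wpM2l => //; lra.
split.
- by apply: le_trans (KL _ _ pt qt) _; rewrite -[leLHS]mulr1 le_const //; lra.
- apply: le_trans (ler_normD _ _) _; apply: le_trans (lerD (KL _ _ p1t qt) (KL _ _ pt q1t)) _.
  by rewrite (_ : _ + _ = K * L * 2); [apply: le_const; lra|ring].
set rp := p s - p t - (s - t) * p1 t in pst; set rq := q s - q t - (s - t) * q1 t in qst.
have -> : p s * q s - p t * q t - (s - t) * (p1 t * q t + p t * q1 t) =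
    (s - t) ^+ 2 * (p1 t * q1 t) + (s - t) * (p1 t * rq) + rp * q s + p t * rq.
  by rewrite /rp /rq; ring.
have d2 : 0 <= (s - t) ^+ 2 by exact: sqr_ge0.
have -> : K * L * (3 + `|T|) * (s - t) ^+ 2 = (s - t) ^+ 2 * (K * L) +
    `|T| * (K * (L * (s - t) ^+ 2)) + K * (s - t) ^+ 2 * L + K * (L * (s - t) ^+ 2) by ring.
have prq x : `|x| <= K -> `|x * rq| <= K * (L * (s - t) ^+ 2).
  by move=> xK; rewrite normrM ler_pM.
apply: le_trans (ler_normD _ _) _; apply: lerD; last exact: prq.
apply: le_trans (ler_normD _ _) _; apply: lerD; last by rewrite normrM ler_pM.
apply: le_trans (ler_normD _ _) _; apply: lerD.
  by rewrite normrM (ger0_norm d2) ler_wpM2l // KL.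
rewrite normrM ler_pM // ?prq //.
move: sT tT => /andP[? ?] /andP[? ?].
by rewrite (ger0_norm (x := T)) ?ler_norml; [apply/andP; split|]; lra.
Qed.

Lemma smooth_sum (I : finType) (p : I -> R -> R) :
  (forall i, smooth_on (p i)) -> smooth_on (fun t => \sum_i p i t).
Proof.
move=> ps; have : forall r : seq I, smooth_on (fun t => \sum_(i <- r) p i t).
  elim=> [|i r IH].
    by under eq_fun do rewrite big_nil; exact: smooth_cst.
  by under eq_fun do rewrite big_cons; exact: smoothD.
exact.
Qed.

Lemma diff_on_smooth (p p1 p2 : R -> R) (K : R) : diff_on p p1 -> diff_on p1 p2 ->
  (forall t, 0 <= t <= T -> [/\ `|p t| <= K, `|p1 t| <= K & `|p2 t| <= K]) ->
  smooth_on p.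
Proof.
move=> dp dp1 pK; exists p1, K => s t sT tT; have [pt p1t p2t] := pK t tT; split=> //.
have K0 : 0 <= K := le_trans (normr_ge0 _) pt.
(* With the slope at t removed, the derivative p1 x - p1 t is at most K |x - t|; a second mean value
   estimate gives the square. *)
pose r x := p x - x * p1 t.
have dr : diff_on r (fun x => p1 x - p1 t).
  apply: diff_onB dp _ => x; apply: is_derive_eq; rewrite /GRing.scale /=; ring.
have -> : p s - p t - (s - t) * p1 t = r s - r t by rewrite /r; ring.
rewrite -real_normK ?num_real // expr2 mulrA.
apply: (mean_value_on dr sT tT _) => x /andP[x0 xT] xt.
apply: le_trans (ler_wpM2l K0 xt); apply: (mean_value_on dp1 _ tT _); first lra.
by move=> z /andP[? ?] _; have [] := pK z _; lra.
Qed.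

(** Both slopes are taken at t + tau / 2, which is interior even if t = 0 or t + tau = T; the field
    will be identified with the derivative at interior times only. *)
Lemma midpoint_rule (p w : R -> R) : diff_on p w -> smooth_on w ->
  exists K, forall t tau, 0 <= t -> 0 < tau -> tau <= 1 -> t + tau <= T ->
    `|p (t + tau) - p t - tau * w (t + tau / 2)| <= K * tau ^+ 3 /\
    `|p (t + tau / 2) - p t - tau / 2 * w (t + tau / 2)| <= K * tau ^+ 2.
Proof.
(* 4 K comes from the quadratic remainder, with |x - m| <= 2 tau over a length at most tau; one more
   K pays for the quadratic term, which does not cancel over a half step. *)
move=> dp [w1 [K wK]]; exists (5 * K) => t tau t0 tau0 tau1 tT.
set m := t + tau / 2.
have mT : 0 <= m <= T by rewrite /m; lra.
have [wm w1m _] := wK m m mT mT.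
have K0 : 0 <= K := le_trans (normr_ge0 _) wm.
(* The quadratic term takes the same value at t and t + tau, hence cancels. *)
pose r x := p x - (x * w m + (x - m) ^+ 2 * (w1 m / 2)).
have dr : diff_on r (fun x => w x - (w m + (x - m) * w1 m)).
  by apply: diff_onB dp _ => x; apply: is_derive_eq; rewrite /GRing.scale /=; field.
have rK s : t <= s <= t + tau -> `|r s - r t| <= 4 * K * tau ^+ 3.
  move=> /andP[ts st].
  have -> : 4 * K * tau ^+ 3 = K * (2 * tau) ^+ 2 * tau by ring.
  apply: (@le_trans _ _ (K * (2 * tau) ^+ 2 * `|s - t|)); last first.
    apply: ler_wpM2l; first by rewrite mulr_ge0 ?sqr_ge0.
    by rewrite ger0_norm; lra.
  apply: (mean_value_on dr _ _ _) => [||x /andP[? ?]]; try lra.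
  rewrite (ger0_norm (x := s - t)) ?subr_ge0 // ler_norml => /andP[? ?].
  have xT : 0 <= x <= T by lra.
  rewrite (_ : _ - _ = w x - w m - (x - m) * w1 m); last by ring.
  have [_ _] := wK x m xT mT; move=> /le_trans; apply.
  apply: ler_wpM2l => //; rewrite -[leLHS]real_normK ?num_real //.
  apply: lerXn2r; [exact: normr_ge0|rewrite nnegrE; lra|].
  by rewrite ler_norml /m; apply/andP; split; lra.
split.
  have -> : p (t + tau) - p t - tau * w m = r (t + tau) - r t.
    by rewrite /r /m; field.
  apply: le_trans (rK (t + tau) _) _; first by apply/andP; split; lra.
  by apply: ler_wpM2r; [rewrite exprn_ge0 // ltW|lra].
have -> : p m - p t - tau / 2 * w m = (r m - r t) + - ((tau / 2) ^+ 2 * (w1 m / 2)).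
  by rewrite /r /m; field.
apply: le_trans (ler_normD _ _) _.
have -> : 5 * K * tau ^+ 2 = 4 * K * tau ^+ 2 + tau ^+ 2 * K by ring.
apply: lerD.
  apply: le_trans (rK m _) _; first by rewrite /m; apply/andP; split; lra.
  rewrite [tau ^+ 3]exprSr mulrA -[leRHS]mulr1; apply: ler_wpM2l => //.
  by rewrite mulr_ge0 ?sqr_ge0 // mulr_ge0.
rewrite normrN normrM ger0_norm ?sqr_ge0 // exprMn -mulrA.
apply: ler_wpM2l; first exact: sqr_ge0.
rewrite normrM (ger0_norm (x := 2^-1)); lra.
Qed.

End DerivativesOnSegment.

Section DiffOn.
Context {R : realType} (T : R).

Lemma diff_on_sum n (p dp : 'I_n -> R -> R) : (forall i, diff_on T (p i) (dp i)) ->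
  diff_on T (fun t => \sum_i p i t) (fun t => \sum_i dp i t).
Proof.
move=> dpE; split=> [|t t0 tT].
  by apply: (@sum_continuous _ (subspace `[0, T])) => i; exact: (dpE i).1.
have /is_derive_sum : forall i, is_derive t 1 (p i) (dp i t) by move=> i; exact: (dpE i).2.
by rewrite (_ : \sum_i p i = fun t => \sum_i p i t) // funeqE => s; rewrite fct_sumE.
Qed.

Lemma diff_on_comp (F dF p dp : R -> R) : (forall x : R, is_derive x 1 F (dF x)) ->
  diff_on T p dp -> diff_on T (fun t => F (p t)) (fun t => dF (p t) * dp t).
Proof.
move=> FE [cp dpE]; split=> [|t t0 tT]; last exact: is_derive1_comp (dpE t t0 tT).
apply: within_continuous_comp cp => x _.
by apply/differentiable_continuous/derivable1_diffP; have [] := FE x.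
Qed.

Lemma diff_onZ (c : R) (p dp : R -> R) : diff_on T p dp ->
  diff_on T (fun t => c * p t) (fun t => c * dp t).
Proof.
move=> dp'; apply: (@diff_on_comp (fun x => c * x) (fun=> c)) dp' => x.
by apply: is_derive_eq; rewrite /GRing.scale /=; ring.
Qed.

Lemma diff_on_ext (p dp dq : R -> R) : diff_on T p dp ->
  (forall t, 0 < t -> t < T -> dp t = dq t) -> diff_on T p dq.
Proof. by move=> [cp dpE] dpq; split=> // t t0 tT; rewrite -dpq //; exact: dpE. Qed.

End DiffOn.

(** Estimates made entry by entry come with separate constants; the sum of their absolute values
    serves for all entries. *)
Lemma uniform_constant {R : realType} (I : finType) (P : I -> R -> Prop) :
  (forall i K K', P i K -> K <= K' -> P i K') -> (forall i, exists K, P i K) ->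
  exists K, forall i, P i K.
Proof.
move=> mono /choice [K PK]; exists (\sum_i `|K i|) => i.
apply: mono (PK i) _; rewrite (bigD1 i) //=; apply: le_trans (ler_norm _) _.
by rewrite lerDl sumr_ge0.
Qed.

(** * The exact solution as a trajectory of the extended field *)

Section ExactSolution.
Context {R : realType} {M : nat} (h eps T : R) (f F : R -> R).
Variables (ue : R -> grid R M) (uinit : grid R M) (v : nat -> R -> grid R M).
Notation D := (`[0, T]%classic : set R).
Hypothesis FE : forall x : R, is_derive x 1 F (- f x).
Hypothesis ue_exact : exact_solution h eps f uinit ue.
Hypothesis v0E : forall t, D t -> v 0%N t = ue t.
Hypothesis vS : forall j t, (j < 3)%N -> D t -> has_deriv_in D (v j) t (v j.+1 t).
Hypothesis v_cont : forall j, (j <= 3)%N -> {within D, continuous (v j)}.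

Lemma entry_within_continuous j i k : (j <= 3)%N ->
  {within D, continuous (fun t => v j t i k)}.
Proof.
move=> j3; apply: (@within_continuous_comp _ _ _ D (v j) (fun w => w i k) _ (v_cont j3)).
by move=> w _; exact: coord_continuous.
Qed.

Lemma entry_diff_on j i k : (j < 3)%N ->
  diff_on T (fun t => v j t i k) (fun t => v j.+1 t i k).
Proof.
move=> j3; split=> [|t t0 tT]; first exact: entry_within_continuous (ltnW j3).
apply: is_derive_entry (nbhs_segment t0 tT) (vS j3 _).
by rewrite /= in_itv /= !ltW.
Qed.

(** Expanding [v j] to first order uses bounds up to [v j.+2]; the case j = 1 is what calls for the
    third derivative. *)
Lemma entry_smooth j i k : (j < 2)%N -> smooth_on T (fun t => v j t i k).
Proof.
move=> j2; have bounded l : (l <= 3)%N ->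
    exists K, forall t, 0 <= t <= T -> `|v l t i k| <= K.
  move=> l3; have [K _ vK] := continuous_segment_bounded (@entry_within_continuous l i k l3).
  by exists K => t /andP[? ?]; exact: vK.
have [|K0 vK0] := bounded j; first by rewrite ltnW // ltnW.
have [|K1 vK1] := bounded j.+1; first by rewrite ltnW.
have [//|K2 vK2] := bounded j.+2.
apply: (@diff_on_smooth _ _ _ _ _ (Num.max K0 (Num.max K1 K2))
  (@entry_diff_on j i k _) (@entry_diff_on j.+1 i k _)) => //; first exact: ltnW.
by move=> t tT; rewrite !le_max vK0 ?vK1 ?vK2 ?orbT.
Qed.

(** Inside (0, T), the derivatives relative to [0, T] and to [0, +oo[ are limits of the same
    two-sided difference quotient. *)
Lemma exact_interior t : 0 < t -> t < T ->
  v 1%N t = eps ^+ 2 *: glap h (v 0%N t) + map_mx f (v 0%N t).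
Proof.
move=> t0 tT; have tD := nbhs_segment t0 tT.
have Dt : D t := nbhs_singleton tD.
have dv := has_deriv_in_interior tD (vS (isT : (0 < 3)%N) Dt).
have t0oo : nbhs t `[0, +oo[%classic.
  by apply: filterS tD => s /=; rewrite !in_itv /= andbT => /andP[].
have := has_deriv_in_interior t0oo (ue_exact.2 t (ltW t0)).
rewrite v0E // => due.
apply: (@norm_cvg_unique _ _ _ _ _ _ dv).
apply: cvg_trans due; apply: near_eq_cvg.
by apply: filterS (nbhs_dnbhs tD) => s Ds; rewrite !v0E.
Qed.

Let energy t := E1h h F (v 0%N t).
(** Inside (0, T) the first factor is f(u), so this is - <f(u), u'>, the derivative of the energy,
    in a form polynomial in the entries of [v 0] and [v 1]. *)
Let denergy t := - gdot h (v 1%N t - eps ^+ 2 *: glap h (v 0%N t)) (v 1%N t).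

Lemma energy_diff_on : diff_on T energy denergy.
Proof.
apply: (diff_on_ext (dp := fun t => h ^+ 2 * \sum_i \sum_j
    (- f (v 0%N t i j) * v 1%N t i j)) _ _) => [|t t0 tT].
  rewrite /energy /E1h /gdot; under eq_fun do under eq_bigr do under eq_bigr do
    rewrite !mxE mulr1.
  apply: diff_onZ; apply: diff_on_sum => i; apply: diff_on_sum => j.
  exact: (diff_on_comp FE (@entry_diff_on 0%N i j isT)).
have fE : v 1%N t - eps ^+ 2 *: glap h (v 0%N t) = map_mx f (v 0%N t).
  by rewrite exact_interior // addrC addKr.
rewrite /denergy fE /gdot -mulrN -sumrN; congr (_ * _).
apply: eq_bigr => i _; rewrite -sumrN; apply: eq_bigr => j _.
by rewrite !mxE mulNr.
Qed.

Lemma denergy_smooth : smooth_on T denergy.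
Proof.
have s0 k l : smooth_on T (fun t => v 0%N t k l) by exact: entry_smooth.
rewrite /denergy /gdot; under eq_fun do rewrite -mulNr.
apply: smoothM; first exact: smooth_cst.
apply: smooth_sum => i; apply: smooth_sum => j.
apply: smoothM; last exact: entry_smooth.
rewrite (_ : (fun _ => _) = fun t => v 1%N t i j + - eps ^+ 2 * (h ^- 2 *
  (v 0%N t (ordS i) j + v 0%N t (ord_pred i) j + v 0%N t i (ordS j)
   + v 0%N t i (ord_pred j) + (-4) * v 0%N t i j))); last first.
  by apply/funext => t; rewrite !mxE; ring.
apply: smoothD; first exact: entry_smooth.
do 2 (apply: smoothM; first exact: smooth_cst).
apply: smoothD; last by apply: smoothM => //; exact: smooth_cst.
by do 3 (apply: smoothD => //).
Qed.

Variable sigma : R -> R.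
Hypothesis sigma_gt0 : forall r, 0 < sigma r.
Hypothesis lipG : locLip (@gsav_field R M h eps f F sigma).
Notation G := (@gsav_field R M h eps f F sigma).

Let y t : grid R M * R := (v 0%N t, energy t).

(** On the trajectory s equals the energy of u, so g = 1 and the extended field reduces to the
    differential equation and the chain rule for the energy. *)
Lemma field_interior t : 0 < t -> t < T -> G (y t) = (v 1%N t, denergy t).
Proof.
move=> t0 tT; have v1E := exact_interior t0 tT.
have g1 : gfun h F sigma (v 0%N t) (energy t) = 1 by rewrite /gfun divff // gt_eqF.
have duE : gsav_du h eps f F sigma (y t) = v 1%N t by rewrite v1E /gsav_du g1 scale1r.
rewrite /gsav_field duE g1 mulN1r /denergy; congr (_, - gdot _ _ _).
by rewrite v1E addrC addKr.
Qed.

Lemma trajectory_bounded : exists B, forall t, 0 <= t -> t <= T -> `|y t| <= B.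
Proof.
have [K vK] : exists K, forall ij : 'I_M * 'I_M, forall t, 0 <= t <= T ->
    `|v 0%N t ij.1 ij.2| <= K.
  apply: uniform_constant => [ij K K' vK KK' t tT|ij].
    exact: le_trans (vK t tT) KK'.
  have [p1 [K vK]] := @entry_smooth 0 ij.1 ij.2 isT.
  by exists K => t tT; have [] := vK t t tT tT.
have [K' _ eK] := continuous_segment_bounded energy_diff_on.1.
exists (Num.max `|K| K') => t t0 tT.
have tT' : 0 <= t <= T by rewrite t0.
rewrite prod_normE ge_max !le_max eK // orbT andbT; apply/orP; left.
by apply/mx_norm_leP => // i j; apply: le_trans (vK (i, j) t tT') (ler_norm _).
Qed.

Lemma trajectory_midpoint : exists K, forall t tau,
  0 <= t -> 0 < tau -> tau <= 1 -> t + tau <= T ->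
  `|y (t + tau) - y t - tau *: G (y (t + tau / 2))| <= K * tau ^+ 3 /\
  `|y (t + tau / 2) - y t - (tau / 2) *: G (y t)| <= K * tau ^+ 2.
Proof.
have [K1 vK] : exists K, forall ij : 'I_M * 'I_M, forall t tau,
    0 <= t -> 0 < tau -> tau <= 1 -> t + tau <= T ->
    `|v 0%N (t + tau) ij.1 ij.2 - v 0%N t ij.1 ij.2
      - tau * v 1%N (t + tau / 2) ij.1 ij.2| <= K * tau ^+ 3 /\
    `|v 0%N (t + tau / 2) ij.1 ij.2 - v 0%N t ij.1 ij.2
      - tau / 2 * v 1%N (t + tau / 2) ij.1 ij.2| <= K * tau ^+ 2.
  apply: uniform_constant => [ij K K' vK KK' t tau t0 tau0 tau1 tT|ij].
    have [v1 v2] := vK t tau t0 tau0 tau1 tT.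
    by split; [apply: le_trans v1 _|apply: le_trans v2 _];
      rewrite ler_wpM2r // exprn_ge0 // ltW.
  exact: (midpoint_rule (@entry_diff_on 0 ij.1 ij.2 isT) (@entry_smooth 1 ij.1 ij.2 isT)).
have [K2 eK] := midpoint_rule energy_diff_on denergy_smooth.
have [By yB] := trajectory_bounded.
have [Kg Kg0 GK] := locLipP lipG By; have [g g0 Gg] := locLip_bounded lipG By.
pose K := Num.max `|K1| K2.
have K0 : 0 <= K by rewrite le_max normr_ge0.
(* Replacing G (y m) by G (y t) in the half step costs tau/2 Kg |y m - y t|, where |y m - y t| <= (K
   + g) tau. *)
exists (K + Kg * (K + g)) => t tau t0 tau0 tau1 tT.
have [e1 e2] := eK t tau t0 tau0 tau1 tT.
set m := t + tau / 2; have [m0 mT] : 0 < m /\ m < T by rewrite /m; split; lra.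
have ymE := field_interior m0 mT.
have t3 : 0 <= tau ^+ 3 by rewrite exprn_ge0 // ltW.
have t2 : 0 <= tau ^+ 2 by rewrite exprn_ge0 // ltW.
have ym1 : `|y (t + tau) - y t - tau *: G (y m)| <= K * tau ^+ 3.
  rewrite ymE prod_normE ge_max; apply/andP; split => /=; last first.
    by apply: le_trans e1 _; rewrite ler_wpM2r // le_max lexx orbT.
  apply: (@le_trans _ _ (`|K1| * tau ^+ 3)); last by rewrite ler_wpM2r // le_max lexx.
  apply/mx_norm_leP => [|i j]; first by rewrite mulr_ge0.
  rewrite !mxE; have [/le_trans h1 _] := vK (i, j) t tau t0 tau0 tau1 tT.
  by apply: h1; rewrite ler_wpM2r // ler_norm.
have ym2 : `|y m - y t - (tau / 2) *: G (y m)| <= K * tau ^+ 2.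
  rewrite ymE prod_normE ge_max; apply/andP; split => /=; last first.
    by apply: le_trans e2 _; rewrite ler_wpM2r // le_max lexx orbT.
  apply: (@le_trans _ _ (`|K1| * tau ^+ 2)); last by rewrite ler_wpM2r // le_max lexx.
  apply/mx_norm_leP => [|i j]; first by rewrite mulr_ge0.
  rewrite !mxE; have [_ /le_trans h1] := vK (i, j) t tau t0 tau0 tau1 tT.
  by apply: h1; rewrite ler_wpM2r // ler_norm.
split; first by apply: le_trans ym1 _; rewrite ler_wpM2r // lerDl mulr_ge0 // addr_ge0.
have ymB : `|y m| <= By by apply: yB; exact: ltW.
have ytB : `|y t| <= By by apply: yB => //; lra.
have ymt : `|y m - y t| <= (K + g) * tau.
  rewrite -[y m - y t](subrK ((tau / 2) *: G (y m))).
  apply: le_trans (ler_normD _ _) _; rewrite mulrDl; apply: lerD.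
    apply: le_trans ym2 _; apply: ler_wpM2l => //.
    by rewrite expr2 -[leRHS]mulr1 ler_wpM2l // ltW.
  rewrite normrZ gtr0_norm ?divr_gt0 // mulrC; apply: ler_pM; rewrite ?Gg //; lra.
have -> : y m - y t - (tau / 2) *: G (y t) =
    (y m - y t - (tau / 2) *: G (y m)) + (tau / 2) *: (G (y m) - G (y t)).
  by rewrite scalerBr addrA subrK.
apply: le_trans (ler_normD _ _) _; rewrite [leRHS]mulrDl; apply: lerD => //.
rewrite normrZ gtr0_norm ?divr_gt0 //.
have -> : Kg * (K + g) * tau ^+ 2 = tau * (Kg * ((K + g) * tau)) by ring.
apply: ler_pM => //; [lra|lra|].
by apply: le_trans (GK _ _ ymB ytB) _; exact: ler_wpM2l.
Qed.

End ExactSolution.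

Theorem theorem3p14 :
  exists k : nat,
  forall (R : realType) (L : R) (M : nat) (eps beta kappa T : R)
    (f F sigma : R -> R) (uinit : grid R M) (ue : R -> grid R M),
  let h := L / M%:R in
  0 < L -> (0 < M)%N -> 0 < eps -> 0 < beta -> 0 < kappa -> 0 < T ->
  C1 f -> f beta <= 0 -> 0 <= f (- beta) ->
  (forall x, is_derive x (1 : R) F (- f x)) ->
  C1 sigma -> (forall x, 0 < sigma x) -> (forall x, 0 <= derive1 sigma x) ->
  sup_abs (- beta) beta (derive1 f) <= kappa ->
  gnorm_oo uinit <= beta ->
  exact_solution h eps f uinit ue ->
  Ck_on k `[0, T] ue ->
  exists tau0 C : R, [/\ 0 < tau0, 0 < C &
    forall tau : R, 0 < tau -> tau <= tau0 ->
    forall n : nat, n%:Z <= Num.floor (T / tau) ->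
      let: (un, sn) := gsav_ei2 h eps kappa f F sigma tau uinit n in
      gnorm h (un - ue (n%:R * tau))
        + `|sn - E1h h F (ue (n%:R * tau))| <= C * tau ^+ 2].
Proof.
(* Three derivatives of u: the midpoint rule needs u' expanded to first order with a quadratic
   remainder. *)
exists 3%N => R L M eps beta kappa T f F sigma uinit ue h L0 M0 _ _ _ T0 C1f _ _ FE
  C1s sigma_gt0 _ _ _ ue_exact [v [v0E vS v_cont]].
have h0 : 0 < h by rewrite divr_gt0 // ltr0n.
have cont (p : R -> R) : C1 p -> continuous p.
  by move=> [dp _] x; apply/differentiable_continuous/derivable1_diffP; exact: dp.
have lipf := C1_locLip C1f; have lips := C1_locLip C1s.
have lipF : locLip F.
  by apply: derive_locLip FE _ => x; apply: continuousN; exact: cont.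
have lipG := @locLip_gsav_field R M h eps _ _ _ lipf lipF lips (cont _ C1s) sigma_gt0.
have PhiO := @gsav_ei2_step_midpoint R M h eps _ _ _ lipf lipF lips (cont _ C1s) sigma_gt0 kappa h0.
have [By yB] := trajectory_bounded FE ue_exact v0E vS v_cont.
have [Ky yK] := trajectory_midpoint FE ue_exact v0E vS v_cont sigma_gt0 lipG.
have [tau0 [C [tau00 C0 err]]] := midpoint_convergence lipG PhiO T0 yB yK.
have hM0 : 0 <= h * M%:R by rewrite mulr_ge0 // ltW.
(* The factor h M converts the max norm into [gnorm]; the 1 is for the scalar error. *)
exists tau0, ((h * M%:R + 1) * C); split => //.
  by rewrite mulr_gt0 // ltr_wpDl.
move=> tau tau_gt0 tau_le n nT.
have {}nT : n%:R * tau <= T by rewrite -ler_pdivlMr // -[n%:R]/(n%:Z%:~R) -floor_ge_int.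
have tD : `[0, T]%classic (n%:R * tau).
  by rewrite /= in_itv /= nT andbT mulr_ge0 // ltW.
have D0 : `[0, T]%classic (0 : R) by rewrite /= in_itv /= lexx ltW.
have := err tau tau_gt0 tau_le n nT.
rewrite /= !v0E // ue_exact.1 -/(gsav_ei2 _ _ _ _ _ _ _ _ _).
case: gsav_ei2 => un sn errn.
rewrite -mulrA mulrDl mul1r; apply: lerD.
  apply: le_trans (gnorm_le _ (ltW h0)) _; apply: ler_wpM2l => //.
  by apply: le_trans errn; rewrite prod_normE le_max lexx.
by apply: le_trans errn; rewrite prod_normE le_max lexx orbT.
Qed.
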